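(* Let $X_n^{\mathrm{DLRA}}=m_n^{\mathrm{DLRA}}+U_n^\top Y_n$ be a rank-$k$ dynamical low-rank state at time $t_n$, let $C_{Y_n}=\mathbb{E}[Y_nY_n^\top]$, $P_{U_n}=U_n^\top U_n$, $P_{U_n}^\perp=I_{d\times d}-P_{U_n}$. The triplet $(\Delta m_n^{\mathrm{DLRA}},\Delta U_n,\Delta Y_n)$ given by $$\Delta m_n^{\mathrm{DLRA}}=\mathbb{E}[A(t_n,X_n^{\mathrm{DLRA}})]\Delta t_n+U_n^\top C_{Y_n}U_nH(t_n)^\top R^{-1}\bigl(Z_{n+1}-Z_n-H(t_n)\mathbb{E}[X_n^{\mathrm{DLRA}}]\Delta t_n\bigr),$$ $$\Delta U_n=C_{Y_n}^{-1}\mathbb{E}\bigl[Y_n\mathring A(t_n,X_n^{\mathrm{DLRA}})^\top\bigr]P_{U_n}^\perp\Delta t_n+C_{Y_n}^{-1}U_nQP_{U_n}^\perp\Delta t_n,$$ $$\Delta Y_n=U_n\mathring A(t_n,X_n^{\mathrm{DLRA}})\Delta t_n+U_nQ^{1/2}\Delta W_n-C_{Y_n}U_nH(t_n)^\top R^{-1}H(t_n)U_n^\top Y_n\Delta t_n-C_{Y_n}U_nH(t_n)^\top R^{-1/2}\Delta B_n$$ solves, at first-order approximation in $\Delta t_n$ (in the sense made precise in the context), the minimization problem $$\min_{\Delta m,\ \Delta U,\ \Delta Y}\ \bigl|m_{n+1}-(m_n^{\mathrm{DLRA}}+\Delta m)\bigr|^2+\bigl\|C_{n+1}-(U_n+\Delta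 U)^\top(C_{Y_n}+\Delta C_Y)(U_n+\Delta U)\bigr\|_{\mathrm F}^2$$ over $\Delta m\in\mathbb{R}^d$, $\Delta U\in\mathbb{R}^{k\times d}$ with $\Delta U\,U_n^\top=0$, and adapted increments $\Delta Y$ with values in $\mathbb{R}^k$, where $C_{Y_n}+\Delta C_Y=\mathbb{E}[(Y_n+\Delta Y)(Y_n+\Delta Y)^\top]$.
   Context: Setting: $A:[0,\infty)\times\mathbb{R}^d\to\mathbb{R}^d$ is a (possibly nonlinear) drift, $H(t)\in\mathbb{R}^{h\times d}$, $h\le d$, $Q\in\mathbb{R}^{d\times d}$ is symmetric positive semidefinite, $R\in\mathbb{R}^{h\times h}$ is symmetric positive definite. $(\mathcal F_t)$ is a filtration, $W$ and $B$ are independent $(\mathcal F_t)$-Brownian motions in $\mathbb{R}^d$ and $\mathbb{R}^h$; $\Delta W_n\sim\mathcal N(0,\Delta t_nI_d)$ and $\Delta B_n\sim\mathcal N(0,\Delta t_nI_h)$ are their increments over $[t_n,t_{n+1}]$, independent of each other and of $\mathcal F_{t_n}$, with $\Delta t_n=t_{n+1}-t_n$. Here $m_n^{\mathrm{DLRA}}\in\mathbb{R}^d$ is deterministic; $U_n\in\mathbb{R}^{k\times d}$ has orthonormal rows, $U_nU_n^\top=I_{k\times k}$; $Y_n\in L^2(\Omega,\mathbb{R}^k)$ is $\mathcal F_{t_n}$-measurable, has zero mean and linearly independent components in $L^2(\Omega)$ (so $C_{Y_n}$ is invertible). $C_n^{\mathrm{DLRA}}=U_n^\top C_{Y_n}U_n$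 is the covariance of $X_n^{\mathrm{DLRA}}$, $\mathring X_n^{\mathrm{DLRA}}=U_n^\top Y_n$, $A(t_n,X_n^{\mathrm{DLRA}})$ is square integrable and $\mathring A(t_n,X_n^{\mathrm{DLRA}})=A(t_n,X_n^{\mathrm{DLRA}})-\mathbb{E}[A(t_n,X_n^{\mathrm{DLRA}})]$. $\|\cdot\|_{\mathrm F}$ is the Frobenius norm. Targets: consider the full-order Euler--Maruyama step $X_{n+1}=X_n^{\mathrm{DLRA}}+A(t_n,X_n^{\mathrm{DLRA}})\Delta t_n+Q^{1/2}\Delta W_n$, $Z_{n+1}=Z_n+H(t_n)X_{n+1}\Delta t_n+R^{1/2}\Delta B_n$ with $Z_n$ given. With $\mathring V=V-\mathbb{E}[V]$, $m_{n+1}$ and $C_{n+1}$ are the Kalman-type approximations of the conditional mean and covariance of $X_{n+1}$ given the observed $Z_{n+1}$: $m_{n+1}=\mathbb{E}[X_{n+1}]+\mathbb{E}[\mathring X_{n+1}\mathring Z_{n+1}^\top]\mathbb{E}[\mathring Z_{n+1}\mathring Z_{n+1}^\top]^{-1}(Z_{n+1}-\mathbb{E}[Z_{n+1}])$ and $C_{n+1}=\mathbb{E}[\mathring X_{n+1}\mathring X_{n+1}^\top]-\mathbb{E}[\mathring X_{n+1}\mathring Z_{n+1}^\top]\mathbb{E}[\mathring Z_{n+1}\mathring Z_{n+1}^\top]^{-1}\mathbb{E}[\mathring Z_{n+1}\mathring X_{n+1}^\top]$. In these formulas $Z_n$ and the observed value of $Z_{n+1}$ in the last factor of $m_{n+1}$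 are treated as given data. Meaning of ''first-order approximation in $\Delta t_n$'': (i) $m_{n+1}$ and $C_{n+1}$ are replaced by their expansions with all terms of order higher than $\Delta t_n$ discarded ($Z_{n+1}-Z_n$ being counted as $O(\Delta t_n^{1/2})$), i.e. by $m_n^{\mathrm{DLRA}}+\mathbb{E}[A(t_n,X_n^{\mathrm{DLRA}})]\Delta t_n+C_n^{\mathrm{DLRA}}H(t_n)^\top R^{-1}(Z_{n+1}-Z_n-H(t_n)\mathbb{E}[X_n^{\mathrm{DLRA}}]\Delta t_n)$ and $C_n^{\mathrm{DLRA}}+\bigl(\mathbb{E}[\mathring X_n^{\mathrm{DLRA}}\mathring A(t_n,X_n^{\mathrm{DLRA}})^\top]+\mathbb{E}[\mathring A(t_n,X_n^{\mathrm{DLRA}})(\mathring X_n^{\mathrm{DLRA}})^\top]+Q-C_n^{\mathrm{DLRA}}H(t_n)^\top R^{-1}H(t_n)C_n^{\mathrm{DLRA}}\bigr)\Delta t_n$ respectively; (ii) the surrogate covariance $(U_n+\Delta U)^\top(C_{Y_n}+\Delta C_Y)(U_n+\Delta U)$ is replaced by its linear part $C_n^{\mathrm{DLRA}}+\Delta U^\top C_{Y_n}U_n+U_n^\top\Delta C_Y\,U_n+U_n^\top C_{Y_n}\Delta U$; (iii) $\Delta Y$ enters only through $\Delta C_Y$, and $\Delta Y_n$ is a solution if $\mathbb{E}[(Y_n+\Delta Y_n)(Y_n+\Delta Y_n)^\top]-C_{Y_n}$ agrees, up to terms of order higher than $\Delta t_n$, with the minimizing symmetric $\Delta C_Y\in\mathbb{R}^{k\times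 k}$ of the resulting least-squares problem in $(\Delta m,\Delta U,\Delta C_Y)$. *)

(* Defs.v *)
From HB Require Import structures.
From mathcomp Require Import all_boot all_order all_algebra.
From mathcomp Require Import all_classical all_reals all_analysis.
Set Implicit Arguments.
Unset Strict Implicit.
Unset Printing Implicit Defensive.
Import Order.TTheory GRing.Theory Num.Theory.
Import numFieldNormedType.Exports.
Local Open Scope classical_set_scope.
Local Open Scope ring_scope.

(* Vectors of R^n are column vectors 'cV[R]_n, whose Borel sigma-algebra is the
   one generated by the coordinate maps. *)

Section Matrices.
Variable R : realType.

(* On column vectors this is the Euclidean norm. *)
Definition frobenius m n (M : 'M[R]_(m, n)) : R :=
  Num.sqrt (\sum_i \sum_j M i j ^+ 2).

Definition psd n (M : 'M[R]_n) : Prop :=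
  M^T = M /\ forall v : 'cV[R]_n, 0 <= (v^T *m M *m v) 0 0.

Definition posdef n (M : 'M[R]_n) : Prop :=
  M^T = M /\ forall v : 'cV[R]_n, v != 0 -> 0 < (v^T *m M *m v) 0 0.

(* S = M^(1/2), which is determined by this property when M is positive
   semidefinite. *)
Definition is_psd_sqrt n (S M : 'M[R]_n) : Prop := psd S /\ S *m S = M.

End Matrices.

Section SigmaAlgebras.
Variables (R : realType) (T : Type).

Definition sigma_rvec n (X : T -> 'cV[R]_n) : set_system T :=
  <<s \bigcup_(i in [set: 'I_n])
        preimage_set_system setT (fun w => X w i 0) measurable >>.

Definition sigma_process n (X : R -> T -> 'cV[R]_n) : set_system T :=
  <<s \bigcup_(t in [set t : R | 0 <= t]) sigma_rvec (X t) >>.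

Definition rvec_measurable (G : set_system T) n (X : T -> 'cV[R]_n) : Prop :=
  forall (i : 'I_n) (B : set R), measurable B -> G [set w | B (X w i 0)].

End SigmaAlgebras.

Definition borel_map (R : realType) m n (f : 'cV[R]_m -> 'cV[R]_n) : Prop :=
  rvec_measurable (sigma_rvec (@id 'cV[R]_m)) f.

Section Probability.
Context (R : realType) (disp : measure_display) (T : measurableType disp).
Variable P : probability T R.

Definition expect m n (M : T -> 'M[R]_(m, n)) : 'M[R]_(m, n) :=
  \matrix_(i, j) fine 'E_P[fun w => M w i j].

Definition centered m n (M : T -> 'M[R]_(m, n)) : T -> 'M[R]_(m, n) :=
  fun w => M w - expect M.

Definition cross_cov m n (X : T -> 'cV[R]_m) (Z : T -> 'cV[R]_n) :
    'M[R]_(m, n) :=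
  expect (fun w => centered X w *m (centered Z w)^T).

Definition square_integrable n (X : T -> 'cV[R]_n) : Prop :=
  forall i : 'I_n, (fun w => X w i 0) \in Lfun P 2%:E.

Definition linearly_independent n (X : T -> 'cV[R]_n) : Prop :=
  forall v : 'cV[R]_n, {ae P, forall w, v^T *m X w = 0} -> v = 0.

Definition indep (G1 G2 : set_system T) : Prop :=
  forall A1 A2, G1 A1 -> G2 A2 -> P (A1 `&` A2) = (P A1 * P A2)%E.

(* X has law N(0, s^2 I_n), i.e. the n-fold product of N(0, s^2); the second
   parameter of normal_prob is the standard deviation. *)
Definition normal_rvec n (s : R) (X : T -> 'cV[R]_n) : Prop :=
  forall B : 'I_n -> set R, (forall i, measurable (B i)) ->
    P [set w | forall i, B i (X w i 0)] =
    (\prod_(i < n) normal_prob 0%R s (B i))%E.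

Definition filtration (F : R -> set_system T) : Prop :=
  [/\ forall t, 0 <= t -> sigma_algebra setT (F t),
      forall t, 0 <= t -> F t `<=` measurable &
      forall s t, 0 <= s -> s <= t -> F s `<=` F t].

Definition brownian (F : R -> set_system T) n (W : R -> T -> 'cV[R]_n) : Prop :=
  [/\ forall t, 0 <= t -> rvec_measurable (F t) (W t),
      {ae P, forall w, W 0 w = 0},
      forall s t, 0 <= s -> s < t ->
        normal_rvec (Num.sqrt (t - s)) (fun w => W t w - W s w),
      forall s t, 0 <= s -> s < t ->
        indep (F s) (sigma_rvec (fun w => W t w - W s w)) &
      {ae P, forall w, forall i : 'I_n,
        {within [set t : R | 0 <= t], continuous (fun t => W t w i 0)}}].

Definition kalman_mean m n (X : T -> 'cV[R]_m) (Z : T -> 'cV[R]_n)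
    (z : 'cV[R]_n) : 'cV[R]_m :=
  expect X + cross_cov X Z *m invmx (cross_cov Z Z) *m (z - expect Z).

Definition kalman_cov m n (X : T -> 'cV[R]_m) (Z : T -> 'cV[R]_n) : 'M[R]_m :=
  cross_cov X X - cross_cov X Z *m invmx (cross_cov Z Z) *m cross_cov Z X.

End Probability.

Section LowRankLeastSquares.
Variables (R : realType) (d k : nat).
Variables (U : 'M[R]_(k, d)) (CY : 'M[R]_k).

Definition surrogate_cov (dU : 'M[R]_(k, d)) (dC : 'M[R]_k) : 'M[R]_d :=
  (U + dU)^T *m (CY + dC) *m (U + dU).

Definition linear_surrogate_cov (dU : 'M[R]_(k, d)) (dC : 'M[R]_k) : 'M[R]_d :=
  U^T *m CY *m U + dU^T *m CY *m U + U^T *m dC *m U + U^T *m CY *m dU.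

Variables (mtar : 'cV[R]_d) (Ctar : 'M[R]_d) (mn : 'cV[R]_d).

Definition objective (dm : 'cV[R]_d) (dU : 'M[R]_(k, d)) (dC : 'M[R]_k) : R :=
  frobenius (mtar - (mn + dm)) ^+ 2 +
  frobenius (Ctar - linear_surrogate_cov dU dC) ^+ 2.

Definition feasible (dU : 'M[R]_(k, d)) (dC : 'M[R]_k) : Prop :=
  dU *m U^T = 0 /\ dC^T = dC.

Definition is_minimizer (dm : 'cV[R]_d) (dU : 'M[R]_(k, d)) (dC : 'M[R]_k) :
    Prop :=
  feasible dU dC /\
  forall dm' dU' dC', feasible dU' dC' ->
    objective dm dU dC <= objective dm' dU' dC'.

End LowRankLeastSquares.

(* Main.v *)
(* Write S for the covariance of the Euler state. Since the Brownian increments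
   are centred, uncorrelated with F_tn-measurable vectors and with each other,
   and have covariance dt I, S = C_n + dt D + dt^2 D' is an explicit polynomial
   in dt, and the Kalman gain is S H^T (R + dt H S H^T)^-1, which differs from
   C_n H^T R^-1 by dt times a convergent matrix; this yields both expansions.

   In the least-squares problem put P = U^T U and let N = dt M be the increment
   of the target covariance. Feasible variations of the linearised surrogate
   cover the three blocks P N P, P N P^perp, P^perp N P and are orthogonal to
   P^perp N P^perp, so the residual of any feasible point is P^perp N P^perp
   plus an orthogonal term L which vanishes at the proposed point; conversely
   U L U^T is the error in Delta C_Y, whence uniqueness. Finally
   E[(Y + dY)(Y + dY)^T] - C_Y - U N U^T is exactly of order dt^2. *)

Require Import Defs.
From HB Require Import structures.
From mathcomp Require Import all_boot all_order all_algebra.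
From mathcomp Require Import all_classical all_reals all_analysis.
From mathcomp Require Import measurable_realfun ring.
Set Implicit Arguments.
Unset Strict Implicit.
Unset Printing Implicit Defensive.
Import Order.TTheory GRing.Theory Num.Theory.
Import numFieldNormedType.Exports.
Local Open Scope classical_set_scope.
Local Open Scope ring_scope.

(* [ring] does not apply to rectangular matrices: abstract the products and
   argue entrywise. *)
Ltac mx_ring :=
  repeat match goal with
  | |- context [@mulmx ?R ?m ?n ?p ?A ?B] =>
    let x := fresh "x" in move: (@mulmx R m n p A B) => x
  end;
  let i := fresh "i" in let j := fresh "j" in
  apply/matrixP => i j; rewrite !mxE; ring.

(** * Moments of the centred normal law *)

Section NormalMoments.
Context {R : realType}.
Local Notation mu := (@lebesgue_measure R).
Local Open Scope ereal_scope.

(** Splitting the line at 0 and reflecting the negative half turns both sides into the same two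
    integrals over the positive half-line, in opposite order. It later makes the positive and
    negative parts of a centred normal variable cancel. *)
Lemma ge0_integralT_oppr (f : R -> R) : (forall x, 0 <= f x)%R ->
  continuous f -> \int[mu]_x (f (- x)%R)%:E = \int[mu]_x (f x)%:E.
Proof.
have split0 (g : R -> R) : (forall x, 0 <= g x)%R -> continuous g ->
    \int[mu]_x (g x)%:E =
    \int[mu]_(x in `[0%R, +oo[) (g (- x)%R)%:E
    + \int[mu]_(x in `[0%R, +oo[) (g x)%:E.
  move=> g0 cg.
  have mg : measurable_fun [set: R] g by exact: continuous_measurable_fun.
  rewrite -(setUv (`]-oo, 0%R[%classic : set R)) ge0_integral_setU//=;
    last 4 first.
  - exact: measurableC.
  - by apply/measurable_EFinP; rewrite setUv.
  - by move=> x _; rewrite lee_fin.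
  - exact/disj_setPCl.
  congr (_ + _); last by rewrite setCitvl.
  rewrite integral_itv_bndo_bndc; last exact/measurable_EFinP/measurable_funTS.
  (* The endpoint 0 is written [- 0] to fit the reflection formula for half-lines. *)
  rewrite -{1}oppr0 ge0_integration_by_substitutionNy//.
  exact: continuous_subspaceT.
move=> f0 cf; rewrite (split0 f)// (split0 (f \o -%R))//=; last first.
  by move=> x; apply: continuous_comp; [exact: opp_continuous|exact: cf].
by under [in X in _ + X = _]eq_integral do rewrite /=; rewrite addeC;
  under [in X in _ + X = _]eq_integral do rewrite /= opprK.
Qed.

Variables (s : R) (s0 : (0 < s)%R).
Local Notation g := (normal_pdf 0 s).
Local Notation nu := (normal_prob 0 s : probability _ R).

(** Change of measure: the Radon-Nikodym derivative of the normal law and its density have the same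
    integral over every measurable set, so they agree almost everywhere. *)
Lemma ge0_integral_normal_prob (f : R -> \bar R) : (forall x, 0 <= f x) ->
  measurable_fun setT f ->
  \int[nu]_x f x = \int[mu]_x (f x * (g x)%:E).
Proof.
move=> f0 mf.
have dom := normal_prob_dominates 0 s.
rewrite -(Radon_Nikodym_SigmaFinite.change_of_variables dom)//=.
have iRN := Radon_Nikodym_SigmaFinite.f_integrable dom.
have mRN := measurable_int _ iRN.
apply: ae_eq_integral => //.
- exact: emeasurable_funM.
- apply: emeasurable_funM => //=; apply/measurable_EFinP.
  exact: measurable_normal_pdf.
- apply: ae_eqe_mul2l => /=; apply: integral_ae_eq => //=.
  + by apply/measurable_EFinP; exact: measurable_normal_pdf.
  + by move=> E _ mE; rewrite -Radon_Nikodym_SigmaFinite.f_integral.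
Qed.

Let gE x : g x = (normal_peak s * expR (- x ^+ 2 / (s ^+ 2 *+ 2)))%R.
Proof. by rewrite normal_pdfE ?gt_eqF// /normal_fun subr0. Qed.

Let is_derive_g (x : R) : is_derive x 1%R g (- x / s ^+ 2 * g x)%R.
Proof.
have -> : g = (fun x => normal_peak s * expR (- x ^+ 2 / (s ^+ 2 *+ 2)))%R.
  by apply/funext => y; exact: gE.
have sn0 : s != 0%R by rewrite gt_eqF.
apply: is_derive_eq.
rewrite /GRing.scale/= ; field.
by rewrite sn0.
Qed.

(* G' = (x^2 - s^2) g has constant sign on [0, s] and on [s, +oo[, so the second
   moment is obtained from the fundamental theorem of calculus on each part. *)
Let G (x : R) : R := (- s ^+ 2 * (x * g x))%R.

Let is_derive_G (x : R) : is_derive x 1%R G ((x ^+ 2 - s ^+ 2) * g x)%R.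
Proof.
have sn0 : s != 0%R by rewrite gt_eqF.
have := is_derive_g x => ?.
rewrite /G; apply: is_derive_eq.
rewrite /GRing.scale/=; field.
by rewrite sn0.
Qed.

Let g0 x : (0 <= g x)%R. Proof. exact: normal_pdf_ge0. Qed.

Let cg : continuous g.
Proof. by apply: continuous_normal_pdf; rewrite gt_eqF. Qed.

Let mg : measurable_fun setT g. Proof. exact: measurable_normal_pdf. Qed.

(** With u = x^2 / (2 s^2), the inequality 1 + u <= exp u bounds x g(x) by a constant multiple of 1
    / x. *)
Let cvg_G : G x @[x --> +oo%R] --> 0%R.
Proof.
rewrite -[X in _ --> X](mulr0 (- s ^+ 2)%R); apply: cvgMr.
have s2 : (0 < s ^+ 2)%R by rewrite exprn_gt0.
have cV : (x^-1 @[x --> +oo] --> (0:R))%R.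
  apply/cvgrVy; first by near=> x; rewrite invr_gt0.
  by under eq_cvg do rewrite /= invrK; exact: cvg_id.
apply: (@squeeze_cvgr _ _ _ _ (fun=> 0%R)
  (fun x => normal_peak s * (s ^+ 2 *+ 2) * x^-1)%R); last 2 first.
- exact: cvg_cst.
- rewrite -[X in _ --> X](mulr0 (normal_peak s * (s ^+ 2 *+ 2))%R).
  exact: cvgMr.
near=> x; have x0 : (0 < x)%R by [].
rewrite mulr_ge0 ?(ltW x0)//= gE mulrCA -mulrA ler_wpM2l ?normal_peak_ge0//.
rewrite mulNr expRN ler_pdivlMr// mulrAC ler_pdivrMr ?expR_gt0// -expr2.
set u := (x ^+ 2 / _)%R; have -> : (x ^+ 2 = (s ^+ 2 *+ 2) * u)%R.
  by rewrite /u mulrC divfK// gt_eqF// pmulrn_lgt0.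
rewrite ler_pM2l ?pmulrn_lgt0//; apply: le_trans (expR_ge1Dx u).
by rewrite lerDr.
Unshelve. all: by end_near. Qed.

Let mh (D : set R) : measurable_fun D (fun x => (x ^+ 2 * g x)%:E).
Proof.
apply/measurable_EFinP/measurable_funTS.
by apply: measurable_funM => //; exact: measurable_funX.
Qed.

Let cG' : continuous (fun x : R => (x ^+ 2 - s ^+ 2) * g x)%R.
Proof.
move=> x; apply: cvgM; last exact: cg.
by apply: cvgB; [exact: exprn_continuous|exact: cvg_cst].
Qed.

Let cG : continuous G.
Proof.
move=> x; apply/differentiable_continuous/derivable1_diffP.
by have [] := is_derive_G x.
Qed.

Let G'E x : (G^`()%classic x = (x ^+ 2 - s ^+ 2) * g x)%R.
Proof. by rewrite derive1E; have [_ ->] := is_derive_G x. Qed.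

(** On [0, s] the derivative of [G] is nonpositive, so the fundamental theorem is applied to [- G].
    The boundary term is added on the left so that all the integrands involved are nonnegative. *)
Let integral0s : \int[mu]_(x in `[0%R, s]) (x ^+ 2 * g x)%:E + (s ^+ 3 * g s)%:E
  = \int[mu]_(x in `[0%R, s]) (s ^+ 2 * g x)%:E.
Proof.
have -> : (s ^+ 3 * g s)%:E =
    \int[mu]_(x in `[0%R, s]) (- ((x ^+ 2 - s ^+ 2) * g x))%:E.
  rewrite (@continuous_FTC2 _ _ (fun x => - G x)%R _ _ s0).
  - by rewrite /G -EFinB; congr EFin; ring.
  - apply: continuous_subspaceT => x; apply: cvgN; exact: cG'.
  - split.
    + by move=> x _; apply: derivableN; have [] := is_derive_G x.
    + by apply: cvgN; apply: cvg_at_right_filter; exact: cG.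
    + by apply: cvgN; apply: cvg_at_left_filter; exact: cG.
  - move=> x _ /=; rewrite derive1E deriveN; last by have [] := is_derive_G x.
    by rewrite -derive1E G'E.
rewrite -ge0_integralD//=.
- by apply: eq_integral => x _; rewrite -EFinD; congr EFin; ring.
- by move=> x _; rewrite lee_fin mulr_ge0// sqr_ge0.
- exact: mh.
- move=> x /=; rewrite in_itv/= => /andP[x0 xs].
  rewrite lee_fin -mulNr mulr_ge0//.
  by rewrite opprB subr_ge0 ler_pXn2r// nnegrE ltW.
- apply/measurable_EFinP/measurable_funTS.
  by apply: continuous_measurable_fun => x; apply: cvgN; exact: cG'.
Qed.

(** On [s, +oo[ the derivative of [G] is nonnegative and [G] vanishes at infinity, so its integral
    is [- G s]. *)
Let integralsy : \int[mu]_(x in `[s, +oo[) (x ^+ 2 * g x)%:E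
  = (s ^+ 3 * g s)%:E + \int[mu]_(x in `[s, +oo[) (s ^+ 2 * g x)%:E.
Proof.
have -> : (s ^+ 3 * g s)%:E =
    \int[mu]_(x in `[s, +oo[) ((x ^+ 2 - s ^+ 2) * g x)%:E.
  rewrite (@ge0_continuous_FTC2y _ _ G _ 0%R).
  - by rewrite /G -EFinB; congr EFin; ring.
  - move=> x sx; rewrite mulr_ge0//.
    by rewrite subr_ge0 ler_pXn2r// nnegrE ?ltW// (lt_le_trans s0).
  - exact: continuous_subspaceT.
  - exact: cvg_G.
  - by move=> x _; have [] := is_derive_G x.
  - by apply: cvg_at_right_filter; exact: cG.
  - by move=> x _; exact: G'E.
rewrite -ge0_integralD//=.
- by apply: eq_integral => x _; rewrite -EFinD; congr EFin; ring.
- move=> x /=; rewrite in_itv/= andbT => sx; rewrite lee_fin mulr_ge0//.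
  by rewrite subr_ge0 ler_pXn2r// nnegrE ?ltW// (lt_le_trans s0).
- apply/measurable_EFinP/measurable_funTS.
  by apply: continuous_measurable_fun => x; exact: cG'.
- by move=> x _; rewrite lee_fin mulr_ge0// sqr_ge0.
- by apply/measurable_EFinP/measurable_funTS; apply: measurable_funM.
Qed.

Let split_s (f : R -> R) : (forall x, 0 <= f x)%R -> measurable_fun setT f ->
  \int[mu]_(x in `[0%R, +oo[) (f x)%:E =
  \int[mu]_(x in `[0%R, s]) (f x)%:E + \int[mu]_(x in `[s, +oo[) (f x)%:E.
Proof.
move=> f0 mf.
rewrite (@itv_bndbnd_setU _ _ (BLeft 0%R) (BRight s) +oo%O)//; last first.
  by rewrite bnd_simp ltW.
rewrite ge0_integral_setU//=.
- rewrite integral_itv_obnd_cbnd//.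
  exact/measurable_EFinP/measurable_funTS.
- exact/measurable_EFinP/measurable_funTS.
- by move=> x _; rewrite lee_fin.
- rewrite disj_set2E; apply/eqP; rewrite -subset0 => x /= [].
  by rewrite !in_itv/= andbT => /andP[_ xs]; rewrite ltNge xs.
Qed.

(** Since [g] has mass 1, the right-hand side is the integral of s^2 g. Both integrands are even,
    and on the half-line the boundary term at s produced by one piece is absorbed by the other. *)
Lemma integral_sqr_normal_pdf : \int[mu]_x (x ^+ 2 * g x)%:E = (s ^+ 2)%:E.
Proof.
have s2 : (0 <= s ^+ 2)%R by rewrite sqr_ge0.
have gs x : (g (- x) = g x)%R by rewrite !gE sqrrN.
have -> : (s ^+ 2)%:E = \int[mu]_x (s ^+ 2 * g x)%:E.
  under eq_integral do rewrite EFinM.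
  rewrite ge0_integralZl//; last 2 first.
  - exact/measurable_EFinP.
  - by move=> x _; rewrite lee_fin.
  by rewrite integral_normal_pdf mule1.
rewrite !ge0_symfun_integralT//.
- congr (_ * _); rewrite -set_itvcy !split_s//.
  + by rewrite integralsy addeA integral0s.
  + by move=> x; rewrite mulr_ge0.
  + by apply: measurable_funM.
  + by move=> x; rewrite mulr_ge0// sqr_ge0.
  + by apply/measurable_EFinP; exact: mh.
- by move=> x; rewrite mulr_ge0.
- by move=> x; apply: cvgM; [exact: cvg_cst|exact: cg].
- by move=> x /=; rewrite gs.
- by move=> x; rewrite mulr_ge0// sqr_ge0.
- by move=> x; apply: cvgM; [exact: exprn_continuous|exact: cg].
- by move=> x /=; rewrite gs sqrrN.
Qed.

Context d (T : measurableType d) (P : probability T R) (X : T -> R).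
Hypothesis mX : measurable_fun setT X.
Hypothesis XN : forall A, measurable A -> P (X @^-1` A) = normal_prob 0 s A.

(** Bundled form of [X], required to speak of its distribution. *)
Let X' : {mfun T >-> measurableTypeR R} := HB.pack (X : T -> measurableTypeR R)
  (isMeasurableFun.Build _ _ _ (measurableTypeR R) X mX).

Let ge0_integral_comp (f : R -> R) : (forall x, 0 <= f x)%R ->
  measurable_fun setT f ->
  \int[P]_w (f (X w))%:E = \int[mu]_x (f x * g x)%:E.
Proof.
move=> f0 mf.
have mEf : measurable_fun setT (EFin \o f) by exact/measurable_EFinP.
under [RHS]eq_integral do rewrite EFinM.
rewrite -(ge0_integral_normal_prob (f := EFin \o f))//.
have := @ge0_integral_pushforward _ _ T (measurableTypeR R) R X mX P setT
  (EFin \o f) measurableT mEf (fun x _ => f0 x).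
rewrite preimage_setT => <-.
apply/esym/(eq_measure_integral (distribution P X')) => A mA _.
exact/esym/XN.
Qed.

Lemma normal_Lfun2 : X \in Lfun P 2%:E.
Proof.
rewrite inE; apply/andP; split; first by rewrite inE.
rewrite inE/= /finite_norm unlock /Lnorm poweR_lty//.
rewrite (ge0_integral_comp (f := fun x => `|x| `^ 2)%R).
- rewrite (_ : (fun x => _) = (fun x : R => (x ^+ 2 * g x)%:E)).
    by rewrite integral_sqr_normal_pdf ltry.
  by apply/funext => x; rewrite powR_mulrn// real_normK ?num_real.
- by move=> x; rewrite powR_ge0.
- by apply: (measurableT_comp (measurable_powR _)).
Qed.

Lemma normal_expectation_sqr : 'E_P[X \* X] = (s ^+ 2)%:E.
Proof.
rewrite unlock; transitivity (\int[mu]_x (x ^+ 2 * g x)%:E).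
  apply: (ge0_integral_comp (f := fun x => x * x)%R).
  - by move=> x; rewrite -expr2 sqr_ge0.
  - exact: measurable_funM.
exact: integral_sqr_normal_pdf.
Qed.

(** The density is even, so the positive and negative parts have equal integrals; integrability
    makes this common value finite, so that the difference is 0. *)
Lemma normal_expectation : 'E_P[X] = 0.
Proof.
have iX : P.-integrable setT (EFin \o X).
  apply/Lfun1_integrable/Lfun_subset12; last exact: normal_Lfun2.
  by rewrite fin_num_measure.
have mpos : measurable_fun [set: R] (fun x : R => Num.max x 0%R).
  by apply: measurable_maxr.
have mneg : measurable_fun [set: R] (fun x : R => Num.max (- x)%R 0%R).
  by apply: measurable_maxr.
have pos0 (x : R) : (0 <= Num.max x 0)%R by rewrite le_max lexx orbT.
have posE : \int[P]_x (EFin \o X)^\+ x = \int[mu]_x (Num.max x 0 * g x)%:E.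
  rewrite -(ge0_integral_comp (f := fun x => Num.max x 0%R))//.
  by apply: eq_integral => x _; rewrite funeposE/= EFin_max.
rewrite unlock integralE/= posE.
have -> : \int[P]_x (EFin \o X)^\- x =
    \int[mu]_x (Num.max (- x)%R 0%R * g (- x)%R)%:E.
  rewrite (eq_integral (fun x => (Num.max (- X x)%R 0%R)%:E)); last first.
    by move=> x _; rewrite funenegE/= EFin_max.
  transitivity (\int[mu]_x (Num.max (- x)%R 0%R * g x)%:E).
    by apply: (ge0_integral_comp (f := fun x => Num.max (- x)%R 0%R)).
  by apply: eq_integral => x _; rewrite !gE sqrrN.
rewrite (ge0_integralT_oppr (f := fun x => Num.max x 0 * g x)%R).
- rewrite subee// -posE.
  exact: integrable_pos_fin_num.
- by move=> x; rewrite mulr_ge0.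
- move=> x; apply: cvgM; last exact: cg.
  by apply: continuous_max; [exact: cvg_id|exact: cvg_cst].
Qed.

End NormalMoments.

(** * Independence and second moments of random vectors *)

Section IndepExpectation.
Context {R : realType} d (T : measurableType d) (P : probability T R).
Local Open Scope ereal_scope.

(** The joint law is the product of the marginal laws, and Fubini's theorem factors the integral of
    the product of the coordinates. *)
Lemma indep_expectationM (X Y : T -> R) :
  X \in Lfun P 2%:E -> Y \in Lfun P 2%:E ->
  (forall A B, measurable A -> measurable B ->
    P (X @^-1` A `&` Y @^-1` B) = P (X @^-1` A) * P (Y @^-1` B)) ->
  'E_P[X \* Y] = 'E_P[X] * 'E_P[Y].
Proof.
move=> X2 Y2 XY.
have mX : measurable_fun setT X by move: X2; rewrite inE => /andP[/[!inE]].
have mY : measurable_fun setT Y by move: Y2; rewrite inE => /andP[/[!inE]].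
have X1 := Lfun_subset12 (fin_num_measure P _ measurableT) X2.
have Y1 := Lfun_subset12 (fin_num_measure P _ measurableT) Y2.
have /Lfun1_integrable iXY := Lfun2_mul_Lfun1 X2 Y2.
have /Lfun1_integrable iX := X1.
have /Lfun1_integrable iY := Y1.
pose X' : {mfun T >-> measurableTypeR R} := HB.pack (X : T -> measurableTypeR R)
  (isMeasurableFun.Build _ _ _ (measurableTypeR R) X mX).
pose Y' : {mfun T >-> measurableTypeR R} := HB.pack (Y : T -> measurableTypeR R)
  (isMeasurableFun.Build _ _ _ (measurableTypeR R) Y mY).
pose Z : T -> measurableTypeR R * measurableTypeR R := fun w => (X w, Y w).
have mZ : measurable_fun setT Z by exact: measurable_fun_pair.
pose Z' : {mfun T >-> (measurableTypeR R * measurableTypeR R)%type} :=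
  HB.pack Z (isMeasurableFun.Build _ _ _ _ Z mZ).
pose f (z : measurableTypeR R * measurableTypeR R) : \bar R := (z.1 * z.2)%:E.
have mf : measurable_fun setT f.
  by apply/measurable_EFinP; exact: measurable_funM.
pose nuX := distribution P X'; pose nuY := distribution P Y'.
(* The two measures agree on rectangles, which determines the product measure. *)
have joint A : measurable A -> (nuX \x nuY) A = distribution P Z' A.
  by move=> mA; apply: product_measure_unique => // B C mB mC; exact: XY.
have iZ : (distribution P Z').-integrable setT f.
  exact: (@integrable_pushforward _ _ _ _ _ _ mZ).
have E1 : 'E_P[X \* Y] = \int[distribution P Z']_z f z.
  rewrite unlock.
  by rewrite (@integral_pushforward _ _ _ _ _ _ mZ).
have iprod : (nuX \x nuY).-integrable setT f.
  apply/integrableP; split=> //.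
  rewrite (eq_measure_integral (distribution P Z')); last first.
    by move=> A mA _; exact: joint.
  by case/integrableP : iZ.
have E2 : \int[distribution P Z']_z f z = \int[nuX \x nuY]_z f z.
  by apply: eq_measure_integral => A mA _; exact/esym/joint.
have EX : \int[nuX]_x x%:E = 'E_P[X].
  rewrite unlock.
  by rewrite (@integral_pushforward _ _ T (measurableTypeR R) R X mX).
have EY : \int[nuY]_x x%:E = 'E_P[Y].
  rewrite unlock.
  by rewrite (@integral_pushforward _ _ T (measurableTypeR R) R Y mY).
have iXid : nuX.-integrable setT (@EFin R).
  exact: (@integrable_pushforward _ _ T (measurableTypeR R) R X mX).
have iYid : nuY.-integrable setT (@EFin R).
  exact: (@integrable_pushforward _ _ T (measurableTypeR R) R Y mY).
rewrite E1 E2 -integral12_prod_meas1//.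
transitivity (\int[nuX]_x (x%:E * 'E_P[Y])).
  by apply: eq_integral => x _; rewrite /fubini_F/= -EY -integralZl.
(* Finiteness excludes the infinite values of the expectation of [Y], which then becomes a real
   constant to be pulled out. *)
have := expectation_fin_num Y1; rewrite -EX; case: ('E_P[Y]) => // r _.
by rewrite integralZr.
Qed.

End IndepExpectation.

Section SecondMoments.
Context {R : realType} d (T : measurableType d) (P : probability T R).

Lemma Lfun2_Lfun1 (f : T -> R) : f \in Lfun P 2%:E -> f \in Lfun P 1.
Proof. by apply: Lfun_subset12; exact: fin_num_measure. Qed.

Lemma LfunD p (f g : T -> R) : (1 <= p)%E -> f \in Lfun P p ->
  g \in Lfun P p -> (fun w => f w + g w) \in Lfun P p.
Proof. by move=> p1 fp gp; exact: (Lfun_addr_closed P p1).2. Qed.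

Lemma Lfun2D (f g : T -> R) : f \in Lfun P 2%:E -> g \in Lfun P 2%:E ->
  (fun w => f w + g w) \in Lfun P 2%:E.
Proof. exact: LfunD (lee1n 2). Qed.

Lemma Lfun2Z a (f : T -> R) : f \in Lfun P 2%:E ->
  (fun w => a * f w) \in Lfun P 2%:E.
Proof.
move=> f2; rewrite (_ : (fun _ => _) = a \o* f).
  exact: (Lfun_scale a (ler1n R 2) f2).
by apply/funext => w /=; rewrite mulrC.
Qed.

Lemma Lfun_sum p I (r : seq I) (f : I -> T -> R) : (1 <= p)%E ->
  (forall i, f i \in Lfun P p) -> (fun w => \sum_(i <- r) f i w) \in Lfun P p.
Proof.
move=> p1 fp; elim: r => [|i r IH].
  rewrite (_ : (fun _ => _) = cst 0); first exact: (Lfun_addr_closed P p1).1.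
  by apply/funext => w; rewrite big_nil.
rewrite (_ : (fun _ => _) = (fun w => f i w + \sum_(j <- r) f j w)).
  exact: LfunD.
by apply/funext => w; rewrite big_cons.
Qed.

Lemma fine_expectationD (f g : T -> R) : f \in Lfun P 1 -> g \in Lfun P 1 ->
  fine 'E_P[fun w => f w + g w] = fine 'E_P[f] + fine 'E_P[g].
Proof.
by move=> f1 g1; rewrite (expectationD f1 g1) fineD// expectation_fin_num.
Qed.

Lemma fine_expectationZ a (f : T -> R) : f \in Lfun P 1 ->
  fine 'E_P[fun w => a * f w] = a * fine 'E_P[f].
Proof.
move=> f1; rewrite (_ : (fun _ => _) = a \o* f).
  by rewrite expectationZl// fineM// expectation_fin_num.
by apply/funext => w /=; rewrite mulrC.
Qed.

Lemma fine_expectation_sum I (r : seq I) (f : I -> T -> R) :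
  (forall i, f i \in Lfun P 1) ->
  fine 'E_P[fun w => \sum_(i <- r) f i w] = \sum_(i <- r) fine 'E_P[f i].
Proof.
move=> f1; elim: r => [|i r IH].
  rewrite big_nil (_ : (fun _ => _) = cst 0) ?expectation_cst//.
  by apply/funext => w; rewrite big_nil.
rewrite big_cons -IH -fine_expectationD//; last exact: Lfun_sum.
by congr (fine 'E_P[_]); apply/funext => w; rewrite big_cons.
Qed.

(** Uncentred moments, bilinear on square-integrable vectors; [cross_cov] is by definition [mom] of
    the centred vectors. *)
Definition mom m n (X : T -> 'cV[R]_m) (Z : T -> 'cV[R]_n) : 'M[R]_(m, n) :=
  expect P (fun w => X w *m (Z w)^T).

Lemma momE m n (X : T -> 'cV[R]_m) (Z : T -> 'cV[R]_n) i j :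
  mom X Z i j = fine 'E_P[fun w => X w i 0 * Z w j 0].
Proof.
rewrite mxE; congr (fine 'E_P[_]); apply/funext => w.
by rewrite mxE big_ord1 mxE.
Qed.

Lemma mom_tr m n (X : T -> 'cV[R]_m) (Z : T -> 'cV[R]_n) :
  (mom X Z)^T = mom Z X.
Proof.
apply/matrixP => i j; rewrite mxE !momE; congr (fine 'E_P[_]).
by apply/funext => w; rewrite mulrC.
Qed.

Local Notation L2 := (square_integrable P).

Lemma square_integrable_cst n (c : 'cV[R]_n) : L2 (fun=> c).
Proof. by move=> i; exact: Lfun_cst. Qed.

Lemma square_integrableD n (X Z : T -> 'cV[R]_n) : L2 X -> L2 Z ->
  L2 (fun w => X w + Z w).
Proof.
move=> X2 Z2 i; rewrite (_ : (fun _ => _) = (fun w => X w i 0 + Z w i 0)).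
  exact: Lfun2D.
by apply/funext => w; rewrite mxE.
Qed.

Lemma square_integrableZ n a (X : T -> 'cV[R]_n) : L2 X ->
  L2 (fun w => a *: X w).
Proof.
move=> X2 i; rewrite (_ : (fun _ => _) = (fun w => a * X w i 0)).
  exact: Lfun2Z.
by apply/funext => w; rewrite mxE.
 Qed.

Lemma square_integrableN n (X : T -> 'cV[R]_n) : L2 X -> L2 (fun w => - X w).
Proof.
move=> X2; rewrite (_ : (fun _ => _) = (fun w => (-1) *: X w)).
  exact: square_integrableZ.
by apply/funext => w; rewrite scaleN1r.
Qed.

Lemma square_integrableM m n (A : 'M[R]_(m, n)) (X : T -> 'cV[R]_n) : L2 X ->
  L2 (fun w => A *m X w).
Proof.
move=> X2 i; rewrite (_ : (fun _ => _) = (fun w => \sum_j A i j * X w j 0)).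
  by apply: Lfun_sum => [|j]; [rewrite lee1n|exact: Lfun2Z].
by apply/funext => w; rewrite mxE.
Qed.

Lemma square_integrable_centered n (X : T -> 'cV[R]_n) : L2 X ->
  L2 (centered P X).
Proof.
move=> X2; apply: square_integrableD => //; exact: square_integrable_cst.
Qed.

Lemma expect_cst m n (c : 'M[R]_(m, n)) : expect P (fun=> c) = c.
Proof. by apply/matrixP => i j; rewrite mxE expectation_cst. Qed.

Lemma expectD n (X Z : T -> 'cV[R]_n) : L2 X -> L2 Z ->
  expect P (fun w => X w + Z w) = expect P X + expect P Z.
Proof.
move=> X2 Z2; apply/matrixP => i j; rewrite ord1 !mxE -fine_expectationD//.
- by congr (fine 'E_P[_]); apply/funext => w; rewrite mxE.
- exact: Lfun2_Lfun1.
- exact: Lfun2_Lfun1.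
Qed.

Lemma expectZ n a (X : T -> 'cV[R]_n) : L2 X ->
  expect P (fun w => a *: X w) = a *: expect P X.
Proof.
move=> X2; apply/matrixP => i j; rewrite ord1 !mxE -fine_expectationZ//.
- by congr (fine 'E_P[_]); apply/funext => w; rewrite mxE.
- exact: Lfun2_Lfun1.
Qed.

Lemma expectMl m n (A : 'M[R]_(m, n)) (X : T -> 'cV[R]_n) : L2 X ->
  expect P (fun w => A *m X w) = A *m expect P X.
Proof.
move=> X2; apply/matrixP => i j; rewrite ord1 !mxE.
transitivity (fine 'E_P[fun w => \sum_k A i k * X w k 0]).
  by congr (fine 'E_P[_]); apply/funext => w; rewrite mxE.
rewrite fine_expectation_sum; last by move=> k; exact/Lfun2_Lfun1/Lfun2Z.
by apply: eq_bigr => k _; rewrite mxE fine_expectationZ//; exact: Lfun2_Lfun1.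
Qed.

Lemma momDl m n (X X' : T -> 'cV[R]_m) (Z : T -> 'cV[R]_n) :
  L2 X -> L2 X' -> L2 Z ->
  mom (fun w => X w + X' w) Z = mom X Z + mom X' Z.
Proof.
move=> X2 X'2 Z2; apply/matrixP => i j.
rewrite [RHS]mxE !momE -fine_expectationD.
- by congr (fine 'E_P[_]); apply/funext => w; rewrite mxE mulrDl.
- exact: Lfun2_mul_Lfun1.
- exact: Lfun2_mul_Lfun1.
Qed.

Lemma momZl m n a (X : T -> 'cV[R]_m) (Z : T -> 'cV[R]_n) :
  L2 X -> L2 Z -> mom (fun w => a *: X w) Z = a *: mom X Z.
Proof.
move=> X2 Z2; apply/matrixP => i j; rewrite [RHS]mxE !momE -fine_expectationZ.
- by congr (fine 'E_P[_]); apply/funext => w; rewrite mxE mulrA.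
- exact: Lfun2_mul_Lfun1.
Qed.

Lemma momNl m n (X : T -> 'cV[R]_m) (Z : T -> 'cV[R]_n) :
  L2 X -> L2 Z -> mom (fun w => - X w) Z = - mom X Z.
Proof.
move=> X2 Z2; rewrite -scaleN1r -momZl//; congr mom.
by apply/funext => w; rewrite scaleN1r.
Qed.

Lemma momMl p m n (A : 'M[R]_(p, m)) (X : T -> 'cV[R]_m) (Z : T -> 'cV[R]_n) :
  L2 X -> L2 Z -> mom (fun w => A *m X w) Z = A *m mom X Z.
Proof.
move=> X2 Z2; apply/matrixP => i j; rewrite [RHS]mxE momE.
transitivity (fine 'E_P[fun w => \sum_k (A i k * X w k 0) * Z w j 0]).
  by congr (fine 'E_P[_]); apply/funext => w; rewrite mxE mulr_suml.
have AXZ1 k : (fun w => A i k * X w k 0 * Z w j 0) \in Lfun P 1.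
  by apply: (Lfun2_mul_Lfun1 (f := fun w => A i k * X w k 0));
    first exact: Lfun2Z.
rewrite fine_expectation_sum//; apply: eq_bigr => k _.
rewrite momE -fine_expectationZ; last exact: Lfun2_mul_Lfun1.
by congr (fine 'E_P[_]); apply/funext => w; rewrite mulrA.
Qed.

Lemma momDr m n (X : T -> 'cV[R]_m) (Z Z' : T -> 'cV[R]_n) :
  L2 X -> L2 Z -> L2 Z' ->
  mom X (fun w => Z w + Z' w) = mom X Z + mom X Z'.
Proof. by move=> *; rewrite -mom_tr momDl// linearD/= !mom_tr. Qed.

Lemma momZr m n a (X : T -> 'cV[R]_m) (Z : T -> 'cV[R]_n) :
  L2 X -> L2 Z -> mom X (fun w => a *: Z w) = a *: mom X Z.
Proof. by move=> *; rewrite -mom_tr momZl// linearZ/= mom_tr. Qed.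

Lemma momNr m n (X : T -> 'cV[R]_m) (Z : T -> 'cV[R]_n) :
  L2 X -> L2 Z -> mom X (fun w => - Z w) = - mom X Z.
Proof. by move=> *; rewrite -mom_tr momNl// linearN/= mom_tr. Qed.

Lemma momMr p m n (A : 'M[R]_(p, n)) (X : T -> 'cV[R]_m) (Z : T -> 'cV[R]_n) :
  L2 X -> L2 Z -> mom X (fun w => A *m Z w) = mom X Z *m A^T.
Proof. by move=> *; rewrite -mom_tr momMl// trmx_mul mom_tr. Qed.

(** The scalar v^T X is treated as a vector of size 1, and bilinearity moves v out of its moment. *)
Lemma mom_psd n (X : T -> 'cV[R]_n) (v : 'cV[R]_n) : L2 X ->
  ((v^T *m mom X X *m v) 0 0 = fine 'E_P[fun w => (v^T *m X w) 0 0 ^+ 2]).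
Proof.
move=> X2; have := @momE 1 1 (fun w => v^T *m X w) (fun w => v^T *m X w) 0 0.
rewrite momMl ?momMr// ?trmxK ?mulmxA//; last exact: square_integrableM.
Qed.

End SecondMoments.

(** * Measurability of random vectors and moments of normal vectors *)

Section RandomVectors.
Context {R : realType} d (T : measurableType d).
Implicit Types G : set_system T.

(** Gives access, for a set system [G] that is a sigma-algebra, to the closure properties of
    measurable functions. *)
Lemma measurable_fun_g_sigma_algebraP G (f : T -> R) : sigma_algebra setT G ->
  (forall B, measurable B -> G (f @^-1` B)) <->
  measurable_fun [set: g_sigma_algebraType G] (f : g_sigma_algebraType G -> R).
Proof.
move=> sG; split=> [Gf _ B mB|mf B mB].
  by rewrite setTI /measurable/= sigma_algebra_id//; exact: Gf.
by have := mf measurableT B mB; rewrite setTI /measurable/= sigma_algebra_id.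
Qed.

Lemma rvec_measurable_cst G n (c : 'cV[R]_n) : sigma_algebra setT G ->
  rvec_measurable G (fun=> c).
Proof. by move=> sG i; apply/measurable_fun_g_sigma_algebraP. Qed.

Lemma rvec_measurableD G n (X Z : T -> 'cV[R]_n) : sigma_algebra setT G ->
  rvec_measurable G X -> rvec_measurable G Z ->
  rvec_measurable G (fun w => X w + Z w).
Proof.
move=> sG mX mZ i.
apply/(measurable_fun_g_sigma_algebraP (fun w => (X w + Z w) i 0) sG).
rewrite (_ : (fun _ => _) = (fun w => X w i 0 + Z w i 0)); last first.
  by apply/funext => w; rewrite mxE.
by apply: measurable_funD; apply/(measurable_fun_g_sigma_algebraP _ sG);
  [exact: mX|exact: mZ].
Qed.

Lemma rvec_measurableM G m n (A : 'M[R]_(m, n)) (X : T -> 'cV[R]_n) :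
  sigma_algebra setT G -> rvec_measurable G X ->
  rvec_measurable G (fun w => A *m X w).
Proof.
move=> sG mX i.
apply/(measurable_fun_g_sigma_algebraP (fun w => (A *m X w) i 0) sG).
rewrite (_ : (fun _ => _) = (fun w => \sum_j A i j * X w j 0)); last first.
  by apply/funext => w; rewrite mxE.
apply: measurable_sum => j; apply: measurable_funM => //.
by apply/(measurable_fun_g_sigma_algebraP _ sG); exact: mX.
Qed.

Lemma rvec_measurableZ G n a (X : T -> 'cV[R]_n) : sigma_algebra setT G ->
  rvec_measurable G X -> rvec_measurable G (fun w => a *: X w).
Proof.
move=> sG mX; under eq_fun do rewrite -mul_scalar_mx.
exact: rvec_measurableM.
Qed.

Lemma rvec_measurableN G n (X : T -> 'cV[R]_n) : sigma_algebra setT G ->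
  rvec_measurable G X -> rvec_measurable G (fun w => - X w).
Proof.
by move=> sG mX; under eq_fun do rewrite -scaleN1r; exact: rvec_measurableZ.
Qed.

Lemma rvec_measurableS G G' n (X : T -> 'cV[R]_n) : G `<=` G' ->
  rvec_measurable G X -> rvec_measurable G' X.
Proof. by move=> GG' mX i B mB; exact/GG'/mX. Qed.

Lemma rvec_measurable_sigma_rvec n (X : T -> 'cV[R]_n) :
  rvec_measurable (sigma_rvec X) X.
Proof.
move=> i B mB; apply: sub_sigma_algebra; exists i => //.
by exists B => //; rewrite setTI.
Qed.

Lemma rvec_measurable_sigma_process n (X : R -> T -> 'cV[R]_n) t : 0 <= t ->
  rvec_measurable (sigma_process X) (X t).
Proof.
move=> t0; apply: rvec_measurableS (@rvec_measurable_sigma_rvec _ (X t)).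
move=> A sA.
by apply: sub_sigma_algebra; exists t.
Qed.

(** The sets whose preimage under [X] lies in [G] form a sigma-algebra containing the generators of
    the Borel sets, hence all Borel sets. *)
Lemma rvec_measurable_comp G m n (f : 'cV[R]_m -> 'cV[R]_n)
    (X : T -> 'cV[R]_m) : sigma_algebra setT G -> borel_map f ->
  rvec_measurable G X -> rvec_measurable G (fun w => f (X w)).
Proof.
move=> sG mf mX i B mB.
have sub : sigma_rvec (@id 'cV[R]_m) `<=` image_set_system setT X G.
  apply: smallest_sub; first exact: sigma_algebra_image.
  move=> _ [j _ [D mD <-]]; rewrite /image_set_system/= !setTI.
  exact: mX.
by have := sub _ (mf i B mB); rewrite /image_set_system/= setTI.
Qed.

Variable P : probability T R.

Lemma rvec_measurable_measurable_fun n (X : T -> 'cV[R]_n) i :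
  rvec_measurable measurable X -> measurable_fun setT (fun w => X w i 0).
Proof. by move=> mX _ B mB; rewrite setTI; exact: mX. Qed.

Lemma mom_indep G1 G2 m n (X : T -> 'cV[R]_m) (Z : T -> 'cV[R]_n) :
  indep P G1 G2 -> rvec_measurable G1 X -> rvec_measurable G2 Z ->
  square_integrable P X -> square_integrable P Z ->
  mom P X Z = expect P X *m (expect P Z)^T.
Proof.
move=> G12 mX mZ X2 Z2; apply/matrixP => i j.
rewrite momE mxE big_ord1 !mxE.
rewrite (indep_expectationM (X2 i) (Z2 j)).
  by rewrite fineM// expectation_fin_num// Lfun2_Lfun1.
by move=> A B mA mB; apply: G12; [exact: mX|exact: mZ].
Qed.

Section Normal.
Variables (s : R) (s0 : 0 < s) (n : nat) (X : T -> 'cV[R]_n).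
Hypothesis mX : rvec_measurable measurable X.
Hypothesis XN : normal_rvec P s X.

(** Take a rectangle whose sides other than the i-th are the whole line: they contribute factors
    1. *)
Let marginal i A : measurable A ->
  P ((fun w => X w i 0) @^-1` A) = normal_prob 0 s A.
Proof.
move=> mA; have := XN (B := fun j => if j == i then A else setT).
rewrite (bigD1 i)//= eqxx big1 ?mule1 => [<-|j /negbTE ->]; last first.
- by rewrite probability_setT.
- by move=> j; case: ifP.
congr (P _); apply/seteqP; split=> w /=; last by move/(_ i); rewrite eqxx.
by move=> Aw j; case: eqP => // ->.
Qed.

Let mXi i : measurable_fun setT (fun w => X w i 0).
Proof. exact: rvec_measurable_measurable_fun. Qed.

Lemma normal_rvec_square_integrable : square_integrable P X.
Proof. by move=> i; exact: (normal_Lfun2 s0 (mXi i) (@marginal i)). Qed.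

Lemma normal_rvec_expect : expect P X = 0.
Proof.
apply/matrixP => i j; rewrite ord1 !mxE.
by rewrite (normal_expectation s0 (mXi i) (@marginal i)).
Qed.

Lemma normal_rvec_mom : mom P X X = (s ^+ 2)%:M.
Proof.
apply/matrixP => i j; rewrite momE !mxE; have [->|ij] := eqVneq i j.
  by rewrite (normal_expectation_sqr s0 (mXi j) (@marginal j)).
rewrite (indep_expectationM (normal_rvec_square_integrable i)
  (normal_rvec_square_integrable j)) => [|A B mA mB].
  by rewrite (normal_expectation s0 (mXi i) (@marginal i)) mul0e.
rewrite !marginal//.
(* A rectangle constraining only the coordinates i and j yields their independence, so the
   off-diagonal moment is a product of zero means. *)
have := XN (B := fun l => if l == i then A else if l == j then B else setT).
have ji : (j == i) = false by rewrite eq_sym (negbTE ij).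
rewrite (bigD1 i)//= eqxx (bigD1 j) ?ji//= eqxx.
rewrite big1 ?mule1 => [<-|l /andP[/negbTE -> /negbTE ->]]; last first.
- by rewrite probability_setT.
- by move=> l; case: ifP => // _; case: ifP.
congr (P _); apply/seteqP; split=> w /=.
  by move=> [Aw Bw] l; case: eqP => [->//|_]; case: eqP => [->|].
move=> ABw; split; first by have := ABw i; rewrite eqxx.
by have := ABw j; rewrite eqxx ji.
Qed.

End Normal.

End RandomVectors.

(** * Limits of matrices *)

Section MatrixLimits.
Context {R : realType} {S : Type} (F : set_system S) {FF : ProperFilter F}.

(** The norm is the maximum of finitely many entries, so the entrywise neighbourhoods can be
    intersected. *)
Lemma cvg_mxP m n (f : S -> 'M[R]_(m, n)) (M : 'M[R]_(m, n)) :
  (forall i j, f x i j @[x --> F] --> M i j) -> f x @[x --> F] --> M.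
Proof.
move=> fM; apply/cvgrPdist_lt => e e0.
have : \forall x \near F, forall i j, `|M i j - f x i j| < e.
  apply: filter_forall => i; apply: filter_forall => j.
  by move/cvgrPdist_lt : (fM i j); apply.
apply: filterS => x Mfx.
rewrite /Num.norm/= mx_normrE; apply/bigmax_ltP; split => // -[i j] _ /=.
by rewrite !mxE.
Qed.

Lemma cvg_mx_coord m n (f : S -> 'M[R]_(m, n)) (M : 'M[R]_(m, n)) i j :
  f x @[x --> F] --> M -> f x i j @[x --> F] --> M i j.
Proof.
move=> fM; apply: (@cvg_comp _ _ _ f (fun N : 'M[R]_(m, n) => N i j) _ _ _ fM).
exact: coord_continuous.
Qed.

Lemma cvg_mulmx m n p (f : S -> 'M[R]_(m, n)) (g : S -> 'M[R]_(n, p))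
    (A : 'M[R]_(m, n)) (B : 'M[R]_(n, p)) :
  f x @[x --> F] --> A -> g x @[x --> F] --> B ->
  f x *m g x @[x --> F] --> A *m B.
Proof.
move=> fA gB; apply: cvg_mxP => i j; rewrite mxE.
under eq_cvg do rewrite mxE.
apply: (cvg_big add_continuous) => k _.
by apply: cvgM; exact: cvg_mx_coord.
Qed.

Lemma cvg_det n (f : S -> 'M[R]_n) (A : 'M[R]_n) :
  f x @[x --> F] --> A -> \det (f x) @[x --> F] --> \det A.
Proof.
move=> fA; apply: (cvg_big add_continuous) => s _.
apply: cvgM; first exact: cvg_cst.
apply: (cvg_big mul_continuous) => i _; exact: cvg_mx_coord.
Qed.

Lemma cvg_adj n (f : S -> 'M[R]_n) (A : 'M[R]_n) :
  f x @[x --> F] --> A -> \adj (f x) @[x --> F] --> \adj A.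
Proof.
move=> fA; apply: cvg_mxP => i j; rewrite mxE.
under eq_cvg do rewrite mxE.
apply: cvgM; first exact: cvg_cst.
apply: cvg_det; apply: cvg_mxP => k l; rewrite !mxE.
by under eq_cvg do rewrite !mxE; exact: cvg_mx_coord.
Qed.

Lemma near_unitmx n (f : S -> 'M[R]_n) (A : 'M[R]_n) : A \in unitmx ->
  f x @[x --> F] --> A -> \forall x \near F, f x \in unitmx.
Proof.
rewrite unitmxE unitfE => A0 fA.
apply: filterS (cvgr_neq0 _ (cvg_det fA) A0) => x.
by rewrite unitmxE unitfE.
Qed.

Lemma cvg_invmx n (f : S -> 'M[R]_n) (A : 'M[R]_n) : A \in unitmx ->
  f x @[x --> F] --> A -> invmx (f x) @[x --> F] --> invmx A.
Proof.
move=> uA fA; have uf := near_unitmx uA fA.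
rewrite {2}/invmx uA.
(* [invmx] is given by the adjugate only on invertible matrices, hence the passage to an eventually
   equal function. *)
apply: (@cvg_trans _ ((\det (f x))^-1 *: \adj (f x) @[x --> F])).
  apply: near_eq_cvg; apply: filterS uf => x ufx.
  by rewrite /invmx ufx.
apply: cvgZ; last exact: cvg_adj.
apply: cvgV; last exact: cvg_det.
by move: uA; rewrite unitmxE unitfE.
Qed.

End MatrixLimits.

Section LittleO.
Context {R : realType}.

(** The form in which the expansions in the time step are proved: the remainder is t times something
    that vanishes in the limit. *)
Lemma eqo_id_at_right m n (f g : R -> 'M[R]_(m, n)) :
  (\forall t \near (0 : R)^'+, f t = t *: g t) ->
  g t @[t --> (0 : R)^'+] --> (0 : 'M[R]_(m, n)) ->
  f =o_ ((0 : R)^'+) (fun t => t).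
Proof.
move=> fE g0; apply/eqoP => e e0.
move/cvgr0Pnorm_le : g0 => /(_ e e0) ge.
near=> t.
rewrite (near fE t)// normrZ mulrC ler_wpM2r//.
by near: t.
Unshelve. all: by end_near. Qed.

End LittleO.

(** The closed formulas for the Euler step are derived for positive t, which is enough for a limit
    at 0 from the right. *)
Lemma eqo_at_right_ext (R : realType) m n (f g : R -> 'M[R]_(m, n)) :
  (forall t, 0 < t -> f t = g t) -> g =o_ ((0 : R)^'+) (fun t => t) ->
  f =o_ ((0 : R)^'+) (fun t => t).
Proof.
move=> fg /eqoP go; apply/eqoP => e e0.
by apply: filterS2 (nbhs_right_gt 0) (go e e0) => t t0; rewrite fg.
Qed.

(** * The least-squares problem *)

Section SurrogateLinearization.
Context {R : realType}.

Lemma mx_norm_coord_le m n (A : 'M[R]_(m, n)) i j : `|A i j| <= `|A|.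
Proof.
rewrite [leRHS]/Num.norm/= mx_normrE.
by apply/bigmax_geP; right => /=; exists (i, j).
Qed.

Lemma mx_norm_leP m n (A : 'M[R]_(m, n)) (c : R) : 0 <= c ->
  (forall i j, `|A i j| <= c) -> `|A| <= c.
Proof.
move=> c0 Ac; rewrite [leLHS]/Num.norm/= mx_normrE.
by apply/bigmax_leP; split => // -[i j] _ /=.
Qed.

Lemma mx_norm_trmx m n (A : 'M[R]_(m, n)) : `|A^T| <= `|A|.
Proof.
by apply: mx_norm_leP => // i j; rewrite mxE; exact: mx_norm_coord_le.
Qed.

(** The maximum norm is not submultiplicative: the factor n counts the terms of each entry of the
    product. *)
Lemma mx_norm_mulmx m n p (A : 'M[R]_(m, n)) (B : 'M[R]_(n, p)) :
  `|A *m B| <= n%:R * `|A| * `|B|.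
Proof.
apply: mx_norm_leP => [|i j]; first by rewrite !mulr_ge0.
rewrite mxE; apply: le_trans (ler_norm_sum _ _ _) _.
have -> : n%:R * `|A| * `|B| = \sum_(k < n) `|A| * `|B|.
  by rewrite sumr_const card_ord -mulrA mulr_natl.
by apply: ler_sum => k _; rewrite normrM ler_pM// mx_norm_coord_le.
Qed.

(** The terms of degree at least two group into two products, each of an increment and of a factor,
    [a] or [b], that vanishes at the origin. *)
Lemma surrogate_cov_linearization d k (U : 'M[R]_(k, d)) (CY : 'M[R]_k) :
  (fun x : 'M[R]_(k, d) * 'M[R]_k =>
     surrogate_cov U CY x.1 x.2 - linear_surrogate_cov U CY x.1 x.2)
    =o_ (nbhs (0 : 'M[R]_(k, d) * 'M[R]_k)) id.
Proof.
pose a (x : 'M[R]_(k, d) * 'M[R]_k) := U^T *m x.2.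
pose b (x : 'M[R]_(k, d) * 'M[R]_k) := x.2 *m U + CY *m x.1 + x.2 *m x.1.
have fE x : surrogate_cov U CY x.1 x.2 - linear_surrogate_cov U CY x.1 x.2 =
    a x *m x.1 + x.1^T *m b x.
  rewrite /surrogate_cov /linear_surrogate_cov /a /b [(U + x.1)^T]linearD/=.
  rewrite !(mulmxDl, mulmxDr) !mulmxA.
  mx_ring.
have c1 : x.1 @[x --> nbhs (0 : 'M[R]_(k, d) * 'M[R]_k)] -->
    (0 : 'M[R]_(k, d)).
  exact: cvg_fst.
have c2 : x.2 @[x --> nbhs (0 : 'M[R]_(k, d) * 'M[R]_k)] -->
    (0 : 'M[R]_k).
  exact: cvg_snd.
have a0 : a @ nbhs (0 : 'M[R]_(k, d) * 'M[R]_k) --> (0 : 'M[R]_(d, k)).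
  rewrite -[X in _ --> X](mulmx0 _ U^T) /a; apply: cvg_mulmx => //.
  exact: cvg_cst.
have b0 : b @ nbhs (0 : 'M[R]_(k, d) * 'M[R]_k) --> (0 : 'M[R]_(k, d)).
  have <- : (0 : 'M[R]_k) *m U + CY *m (0 : 'M[R]_(k, d))
      + (0 : 'M[R]_k) *m (0 : 'M[R]_(k, d)) = 0.
    by rewrite !mul0mx mulmx0 !addr0.
  rewrite /b.
  by apply: cvgD; [apply: cvgD|]; apply: cvg_mulmx => //; exact: cvg_cst.
apply/eqoP => e e0.
(* Each product receives e / 2. Dividing by k + 1 offsets the factor k of [mx_norm_mulmx] and
   remains meaningful for k = 0. *)
have k1 : 0 < (k%:R + 1 : R) by rewrite ltr_pwDr.
have e'0 : 0 < e / 2 / (k%:R + 1) by rewrite !divr_gt0.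
move/cvgr0Pnorm_le : a0 => /(_ _ e'0) a0.
move/cvgr0Pnorm_le : b0 => /(_ _ e'0) b0.
near=> x; rewrite fE [e]splitr mulrDl.
have x1 : `|x.1| <= `|x| by rewrite [leRHS]/Num.norm/= le_max lexx.
have kz (z : R) : 0 <= z -> z <= e / 2 / (k%:R + 1) -> k%:R * z <= e / 2.
  move=> z0; rewrite ler_pdivlMr// mulrC; apply: le_trans.
  by rewrite ler_wpM2r// lerDl.
apply: le_trans (ler_normD _ _) _; apply: lerD.
- apply: le_trans (mx_norm_mulmx _ _) _; apply: ler_pM => //; apply: kz => //.
  by near: x.
- apply: le_trans (mx_norm_mulmx _ _) _; rewrite mulrAC; apply: ler_pM => //.
    by apply: kz => //; near: x.
  exact: le_trans (mx_norm_trmx _) x1.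
Unshelve. all: by end_near. Qed.

End SurrogateLinearization.

(** * Orthogonal decomposition of the least-squares residual *)

Section LeastSquares.
Context {R : realType}.

Let sum_sqr_ge0 m n (A : 'M[R]_(m, n)) : 0 <= \sum_i \sum_j A i j ^+ 2.
Proof. by do 2![apply: sumr_ge0 => ? _]; rewrite sqr_ge0. Qed.

Lemma frobenius_sqr m n (A : 'M[R]_(m, n)) :
  frobenius A ^+ 2 = \tr (A^T *m A).
Proof.
rewrite sqr_sqrtr//.
rewrite exchange_big; apply: eq_bigr => j _; rewrite mxE; apply: eq_bigr => i _.
by rewrite mxE expr2.
Qed.

Lemma frobenius_eq0 m n (A : 'M[R]_(m, n)) : frobenius A ^+ 2 <= 0 -> A = 0.
Proof.
rewrite sqr_sqrtr//.
move=> A0; apply/matrixP => i j; rewrite mxE.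
have ge0 i' : 0 <= \sum_j A i' j ^+ 2 by apply: sumr_ge0 => *; rewrite sqr_ge0.
have /eqP : \sum_i \sum_j A i j ^+ 2 = 0.
  by apply/eqP; rewrite eq_le A0 sumr_ge0.
rewrite psumr_eq0// => /allP/(_ i (mem_index_enum _))/= /eqP/eqP.
rewrite psumr_eq0 => [/allP/(_ j (mem_index_enum _))|*]; last exact: sqr_ge0.
by rewrite sqrf_eq0 => /eqP.
Qed.

Lemma frobenius_orthogonal m n (A B : 'M[R]_(m, n)) : \tr (A^T *m B) = 0 ->
  frobenius (A + B) ^+ 2 = frobenius A ^+ 2 + frobenius B ^+ 2.
Proof.
move=> AB; have BA : \tr (B^T *m A) = 0.
  by rewrite -mxtrace_tr trmx_mul trmxK.
rewrite !frobenius_sqr [(A + B)^T]linearD/= !(mulmxDl, mulmxDr) !mxtraceD.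
by rewrite AB BA addr0 add0r.
Qed.

Variables (d k : nat) (U : 'M[R]_(k, d)) (UU : U *m U^T = 1%:M).
Variables (CY : 'M[R]_k) (CYT : CY^T = CY) (CYu : CY \in unitmx).
Variables (N : 'M[R]_d) (NT : N^T = N) (mn dm : 'cV[R]_d).
Let Pp := 1%:M - U^T *m U.
(** Candidate minimizer: [dU] solves [CY *m dU = U *m N *m Pp] and so fits the two mixed blocks of
    [N], while [dC] fits the block on the range of [U^T]. *)
Let dU := invmx CY *m U *m N *m Pp.
Let dC := U *m N *m U^T.

Let PpT : Pp^T = Pp.
Proof. by rewrite /Pp linearB/= trmx1 trmx_mul trmxK. Qed.

Let UPp : U *m Pp = 0.
Proof. by rewrite /Pp mulmxBr mulmx1 mulmxA UU mul1mx subrr. Qed.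

Let PpU : Pp *m U^T = 0.
Proof. by rewrite -PpT -trmx_mul UPp trmx0. Qed.

Let dUU : dU *m U^T = 0.
Proof. by rewrite /dU -mulmxA PpU mulmx0. Qed.

Let dCT : dC^T = dC.
Proof. by rewrite /dC !trmx_mul trmxK NT mulmxA. Qed.

Let CYdU : CY *m dU = U *m N *m Pp.
Proof. by rewrite /dU !mulmxA mulmxV// mul1mx. Qed.

Let dUCY : dU^T *m CY = Pp *m N *m U^T.
Proof. by rewrite -{1}CYT -trmx_mul CYdU !trmx_mul PpT NT mulmxA. Qed.

(** Block decomposition of [N] obtained from [Pp + U^T *m U = 1]. *)
Let NE : N = Pp *m N *m Pp + Pp *m N *m (U^T *m U) + U^T *m dC *m U
  + U^T *m U *m N *m Pp.
Proof.
have -> : U^T *m dC *m U = (U^T *m U) *m N *m (U^T *m U).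
  by rewrite /dC !mulmxA.
rewrite -mulmxDr subrK mulmx1 -[in RHS]addrA -mulmxDr [U^T *m U + Pp]addrC.
by rewrite subrK mulmx1 -mulmxDl subrK mul1mx.
Qed.

(** Differential at the origin of the surrogate covariance. *)
Let L (E : 'M[R]_(k, d)) (D : 'M[R]_k) :=
  E^T *m CY *m U + U^T *m D *m U + U^T *m CY *m E.

(** The candidate reproduces every block of [N] except [Pp *m N *m Pp]; by linearity, moving away
    from it adds a value of [L]. *)
Let residualE dU' dC' :
  U^T *m CY *m U + N - linear_surrogate_cov U CY dU' dC' =
  Pp *m N *m Pp + L (dU - dU') (dC - dC').
Proof.
rewrite {1}NE /linear_surrogate_cov /L; move: dUCY CYdU.
generalize Pp dU dC => P' dU0 dC0 E1 E2.
rewrite [(dU0 - dU')^T]linearB/= !(mulmxBl, mulmxBr) E1.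
rewrite -[U^T *m CY *m dU0]mulmxA E2 !mulmxA.
mx_ring.
Qed.

(** Each term of [L] starts with [U^T] or ends with [U], so it vanishes between two copies of [Pp];
    cyclicity of the trace brings the copies around it. *)
Let L_orthogonal E D : \tr ((Pp *m N *m Pp)^T *m L E D) = 0.
Proof.
have PLP : Pp *m L E D *m Pp = 0.
  rewrite /L; move: UPp PpU; generalize Pp => P' UP PU.
  rewrite !(mulmxDl, mulmxDr) -!mulmxA UP !mulmxA PU.
  by rewrite !(mul0mx, mulmx0) !addr0.
rewrite !trmx_mul PpT NT -!mulmxA mxtrace_mulC -!mulmxA [Pp *m (_ *m _)]mulmxA.
by rewrite PLP mulmx0 mxtrace0.
Qed.

(** By orthogonality the objective is a sum of squares whose middle term is constant and whose other
    two vanish at the candidate. *)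
Let objectiveE dm' dU' dC' :
  objective U CY (mn + dm) (U^T *m CY *m U + N) mn dm' dU' dC' =
  frobenius (dm - dm') ^+ 2 + frobenius (Pp *m N *m Pp) ^+ 2
  + frobenius (L (dU - dU') (dC - dC')) ^+ 2.
Proof.
rewrite /objective residualE (frobenius_orthogonal (L_orthogonal _ _)).
have -> : mn + dm - (mn + dm') = dm - dm'.
  by rewrite opprD addrACA subrr add0r.
by rewrite addrA.
Qed.

Let feasible_dUdC : feasible U dU dC.
Proof. by []. Qed.

Let frobenius0 m n : frobenius (0 : 'M[R]_(m, n)) ^+ 2 = 0.
Proof. by rewrite frobenius_sqr mulmx0 mxtrace0. Qed.

Let L0 : L 0 0 = 0.
Proof. by rewrite /L trmx0 !(mul0mx, mulmx0) !addr0. Qed.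

Lemma least_squares_minimizer :
  is_minimizer U CY (mn + dm) (U^T *m CY *m U + N) mn dm
    (invmx CY *m U *m N *m (1%:M - U^T *m U)) (U *m N *m U^T).
Proof.
split=> // dm' dU' dC' _; rewrite !objectiveE !subrr L0 !frobenius0.
by rewrite add0r addr0 -addrA addrCA lerDl addr_ge0 ?sqr_ge0.
Qed.

Lemma least_squares_unique dm' dU' dC' :
  is_minimizer U CY (mn + dm) (U^T *m CY *m U + N) mn dm' dU' dC' ->
  dC' = U *m N *m U^T.
Proof.
move=> [feas /(_ dm dU dC feasible_dUdC)].
rewrite !objectiveE !subrr L0 !frobenius0 add0r addr0 -addrA addrCA gerDl.
have := sqr_ge0 (frobenius (dm - dm')) => dm0 le0.
have /frobenius_eq0 L'0 : frobenius (L (dU - dU') (dC - dC')) ^+ 2 <= 0.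
  by apply: le_trans le0; rewrite lerDr.
have [dU'U _] := feas.
have EU : (dU - dU') *m U^T = 0 by rewrite mulmxBl dUU dU'U subrr.
have UE : U *m (dU - dU')^T = 0 by rewrite -[U]trmxK -trmx_mul EU trmx0.
(* The gauge condition, in the forms [EU] and [UE], kills the terms in [E], and [U *m U^T = 1]
   isolates [D]. *)
have : U *m L (dU - dU') (dC - dC') *m U^T = dC - dC'.
  rewrite /L; move: EU UE; generalize (dU - dU') (dC - dC') => E D EU UE.
  rewrite !mulmxDr !mulmxDl -!mulmxA EU UU !mulmxA UE UU.
  by rewrite !(mul0mx, mulmx0, mulmx1, mul1mx) add0r addr0.
by rewrite L'0 mulmx0 mul0mx => /esym/subr0_eq.
Qed.

End LeastSquares.

(** * Covariances of the Euler step *)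

(** A nonzero row in the left kernel would annihilate the quadratic form. *)
Lemma posdef_unitmx (R : realType) n (M : 'M[R]_n) : posdef M -> M \in unitmx.
Proof.
move=> [_ Mpos]; rewrite -row_free_unit -kermx_eq0; apply/rowV0P => v.
move=> /sub_kermxP vM; apply: contraTeq isT => v0.
have : v^T != 0 by apply: contra_neq v0 => v0; rewrite -[v]trmxK v0 trmx0.
by move=> /Mpos; rewrite trmxK vM mul0mx mxE ltxx.
Qed.

(** If the quadratic form vanished at v, the square of v^T X would have zero expectation, so v^T X
    would be almost surely 0, against linear independence. *)
Lemma mom_posdef (R : realType) d (T : measurableType d) (P : probability T R) n
    (X : T -> 'cV[R]_n) : square_integrable P X -> linearly_independent P X ->
  posdef (mom P X X).
Proof.
move=> X2 Xfree; split=> [|v v0]; first exact: mom_tr.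
rewrite mom_psd//; set f := fun w => _.
have vX2 : (fun w => (v^T *m X w) 0 0) \in Lfun P 2%:E.
  exact: (square_integrableM v^T X2).
have if2 : P.-integrable setT (EFin \o f) := Lfun2_integrable_sqr vX2.
have Ef0 : (0 <= 'E_P[f])%E by apply: expectation_ge0 => w; exact: sqr_ge0.
rewrite lt_neqAle fine_ge0// andbT; apply: contra_neq v0 => /esym Ef.
apply: Xfree.
(* [fine] also maps infinite values to 0; integrability rules them out. *)
have {}Ef : ('E_P[f] = 0)%E.
  have := integrable_fin_num measurableT if2.
  by rewrite unlock in Ef *; move/fineK => <-; rewrite Ef.
have /(ae_eq_integral_abs P measurableT (measurable_int _ if2)) :
    (\int[P]_x `|(EFin \o f) x| = 0)%E.
  rewrite -[RHS]Ef unlock; apply: eq_integral => w _ /=.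
  by rewrite ger0_norm// sqr_ge0.
apply: filterS => w /(_ I)/= [] /eqP; rewrite sqrf_eq0 => /eqP vX.
by apply/matrixP => i j; rewrite !ord1 vX mxE.
Qed.

(* Syntax-directed: plain [apply] wastes time unifying the matrix operations. *)
Ltac square_int :=
  lazymatch goal with
  | |- square_integrable ?P (centered _ _) =>
    apply: square_integrable_centered; square_int
  | |- square_integrable ?P (fun w => @?X w + @?Z w) =>
    apply: (square_integrableD (P := P) (X := X) (Z := Z)); square_int
  | |- square_integrable ?P (fun w => - @?X w) =>
    apply: (square_integrableN (P := P) (X := X)); square_int
  | |- square_integrable ?P (fun w => ?a *: @?X w) =>
    apply: (square_integrableZ (P := P) a (X := X)); square_int
  | |- square_integrable ?P (fun w => ?M *m @?X w) =>
    apply: (square_integrableM (P := P) M (X := X)); square_int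
  | |- square_integrable ?P (fun w => ?X w) =>
    change (square_integrable P X); square_int
  | |- square_integrable ?P (fun=> _) => exact: square_integrable_cst
  | |- square_integrable _ _ => assumption
  end.

Lemma cross_cov_tr (R : realType) d (T : measurableType d)
    (P : probability T R) m n (V : T -> 'cV[R]_m) (V' : T -> 'cV[R]_n) :
  (cross_cov P V V')^T = cross_cov P V' V.
Proof. exact: mom_tr. Qed.

(** Applied both to the centred Euler state and to [Y + dY]: in each case the noise [xi] is
    uncorrelated with the other two terms. *)
Lemma mom_step (R : realType) d (T : measurableType d) (P : probability T R) n
    (t : R) (X a xi : T -> 'cV[R]_n) :
  square_integrable P X -> square_integrable P a -> square_integrable P xi ->
  mom P X xi = 0 -> mom P a xi = 0 ->
  mom P (fun w => X w + t *: a w + xi w) (fun w => X w + t *: a w + xi w) =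
  mom P X X + t *: (mom P X a + mom P a X) + t ^+ 2 *: mom P a a + mom P xi xi.
Proof.
move=> X2 a2 xi2 Xxi axi.
have ta2 : square_integrable P (fun w => t *: a w) by square_int.
have Xa2 : square_integrable P (fun w => X w + t *: a w) by square_int.
have Xaxi : mom P (fun w => X w + t *: a w) xi = 0.
  by rewrite (momDl X2)// momZl// Xxi axi scaler0 addr0.
rewrite (momDl Xa2 xi2); last by square_int.
rewrite !(momDr _ Xa2 xi2)// -[mom P xi (fun w => _ + _)]mom_tr Xaxi trmx0.
rewrite addr0 add0r (momDl X2)// !(momDr _ X2)// !momZr// !momZl//.
move: (mom P X X) (mom P X a) (mom P a X) (mom P a a) => m1 m2 m3 m4.
mx_ring.
Qed.

(** Covariance of the noise in [dY]; the cross terms vanish and the minus sign disappears in the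
    square. *)
Lemma mom_noise (R : realType) d (T : measurableType d) (P : probability T R)
    (t : R) n p q (W : T -> 'cV[R]_p) (B : T -> 'cV[R]_q)
    (M : 'M[R]_(n, p)) (N : 'M[R]_(n, q)) :
  square_integrable P W -> square_integrable P B ->
  mom P W W = t%:M -> mom P B B = t%:M -> mom P W B = 0 ->
  mom P (fun w => M *m W w - N *m B w) (fun w => M *m W w - N *m B w) =
  t *: (M *m M^T + N *m N^T).
Proof.
move=> W2 B2 WW BB WB; have BW : mom P B W = 0 by rewrite -mom_tr WB trmx0.
have MW2 : square_integrable P (fun w => M *m W w) by square_int.
have NB2 : square_integrable P (fun w => N *m B w) by square_int.
have NB2' : square_integrable P (fun w => - (N *m B w)) by square_int.
rewrite (momDl MW2 NB2'); last by square_int.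
rewrite !(momDr _ MW2 NB2')// !momNr// !momNl// !momMr// !momMl// WW BB WB BW.
rewrite !(mulmx0, mul0mx) oppr0 addr0 add0r opprK !mul_mx_scalar -!scalemxAl.
by rewrite scalerDr.
Qed.

Section EulerStep.
Context {R : realType} disp (T : measurableType disp) (P : probability T R).
Variables (d h : nat) (t : R).
Variables (W : T -> 'cV[R]_d) (B : T -> 'cV[R]_h) (X A : T -> 'cV[R]_d).
Hypotheses (W2 : square_integrable P W) (B2 : square_integrable P B).
Hypotheses (X2 : square_integrable P X) (A2 : square_integrable P A).
Hypotheses (W0 : expect P W = 0) (B0 : expect P B = 0).
Hypotheses (WW : mom P W W = t%:M) (BB : mom P B B = t%:M).
Hypothesis (WB : mom P W B = 0).
Let Xc := centered P X.
Let Ac := centered P A.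
Hypotheses (XW : mom P Xc W = 0) (XB : mom P Xc B = 0).
Hypotheses (AW : mom P Ac W = 0) (AB : mom P Ac B = 0).
Variables (H : 'M[R]_(h, d)) (zn : 'cV[R]_h).
Variables (sqrtQ : 'M[R]_d) (sqrtRn : 'M[R]_h).
Hypotheses (sqrtQT : sqrtQ^T = sqrtQ) (sqrtRnT : sqrtRn^T = sqrtRn).

Let X1 w := X w + t *: A w + sqrtQ *m W w.
Let Z1 w := zn + t *: (H *m X1 w) + sqrtRn *m B w.

Let Xc2 : square_integrable P Xc.
Proof. exact: square_integrable_centered. Qed.

Let Ac2 : square_integrable P Ac.
Proof. exact: square_integrable_centered. Qed.

Let X12 : square_integrable P X1.
Proof. by rewrite /X1; square_int. Qed.

Let Z12 : square_integrable P Z1.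
Proof. by rewrite /Z1; square_int. Qed.

Lemma expect_euler_state : expect P X1 = expect P X + t *: expect P A.
Proof.
rewrite expectD; [|by square_int..].
rewrite (expectD X2); [|by square_int].
by rewrite expectZ// expectMl// W0 mulmx0 addr0.
Qed.

Let centered_X1 :
  centered P X1 = (fun w => Xc w + t *: Ac w + sqrtQ *m W w).
Proof.
apply/funext => w; rewrite /centered expect_euler_state /X1 /Xc /Ac /centered.
move: (expect P A) (expect P X) => a x; mx_ring.
Qed.

Lemma expect_euler_obs : expect P Z1 = zn + t *: (H *m expect P X1).
Proof.
rewrite expectD; [|by square_int..].
rewrite expectD; [|by square_int..].
rewrite expect_cst expectZ; [|by square_int].
by rewrite (expectMl _ X12) expectMl// B0 mulmx0 addr0.
Qed.

Let centered_Z1 :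
  centered P Z1 = (fun w => (t *: H) *m centered P X1 w + sqrtRn *m B w).
Proof.
apply/funext => w; rewrite {1}/centered expect_euler_obs /centered.
rewrite -scalemxAl mulmxBr /Z1; move: (X1 w) (expect P X1) => x1 e1; mx_ring.
Qed.

(** The Brownian increment has covariance t times the identity, so its contribution [sqrtQ *m sqrtQ]
    is of first order in t. *)
Definition euler_cov := mom P Xc Xc
  + t *: (mom P Xc Ac + mom P Ac Xc + sqrtQ *m sqrtQ) + t ^+ 2 *: mom P Ac Ac.

Let tAc2 : square_integrable P (fun w => t *: Ac w). Proof. by square_int. Qed.

Let XA2 : square_integrable P (fun w => Xc w + t *: Ac w).
Proof. by square_int. Qed.

Let QW2 : square_integrable P (fun w => sqrtQ *m W w).
Proof. by square_int. Qed.

Let XAB : mom P (fun w => Xc w + t *: Ac w) B = 0.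
Proof. by rewrite (momDl Xc2)// momZl// XB AB scaler0 addr0. Qed.

Lemma cross_cov_euler_state : cross_cov P X1 X1 = euler_cov.
Proof.
rewrite /cross_cov -/(mom _ _ _) centered_X1.
rewrite mom_step// ?momMr ?XW ?AW ?mul0mx//.
rewrite !momMl// WW sqrtQT mul_mx_scalar -scalemxAl /euler_cov.
move: (mom P Xc Xc) (mom P Xc Ac) (mom P Ac Xc) (mom P Ac Ac) => m1 m2 m3 m4.
mx_ring.
Qed.

Let BX : mom P B (centered P X1) = 0.
Proof.
rewrite -mom_tr centered_X1 (momDl XA2 QW2)// XAB momMl// WB mulmx0 addr0.
by rewrite trmx0.
Qed.

Let X1c2 : square_integrable P (centered P X1). Proof. by square_int. Qed.

Let HX2 : square_integrable P (fun w => (t *: H) *m centered P X1 w).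
Proof. by square_int. Qed.

Let RB2 : square_integrable P (fun w => sqrtRn *m B w).
Proof. by square_int. Qed.

(** The centred observation is [t *: H] applied to the centred state plus a noise uncorrelated with
    the state. *)
Lemma cross_cov_euler_obs_state :
  cross_cov P Z1 X1 = t *: (H *m euler_cov).
Proof.
rewrite /cross_cov -/(mom _ _ _) centered_Z1 (momDl HX2 RB2)//.
rewrite !momMl// BX mulmx0 addr0 -scalemxAl -cross_cov_euler_state.
by [].
Qed.

Lemma euler_cov_tr : euler_cov^T = euler_cov.
Proof. by rewrite -cross_cov_euler_state cross_cov_tr. Qed.

Lemma cross_cov_euler_state_obs :
  cross_cov P X1 Z1 = t *: (euler_cov *m H^T).
Proof.
rewrite -cross_cov_tr cross_cov_euler_obs_state linearZ/= trmx_mul.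
by rewrite euler_cov_tr.
Qed.

(** The noise contributes at order t and the signal at order t^2; the common factor t is taken out
    to cancel the one in the state-observation covariance. *)
Lemma cross_cov_euler_obs :
  cross_cov P Z1 Z1 =
  t *: (sqrtRn *m sqrtRn + t *: (H *m euler_cov *m H^T)).
Proof.
(* Expanding only the right factor brings back the covariance of the observation with the state,
   already computed. *)
rewrite {1}/cross_cov -/(mom _ _ _) {2}centered_Z1 (momDr _ HX2 RB2)//;
  last by square_int.
rewrite (momMr _ _ X1c2)// 1?(momMr _ _ B2)//; last 2 first.
- by square_int.
- by square_int.
rewrite [mom _ _ (centered P X1)]cross_cov_euler_obs_state.
rewrite centered_Z1 (momDl HX2 RB2)// !momMl//.
rewrite -[mom P (centered P X1) B]mom_tr BX trmx0 mulmx0 add0r BB sqrtRnT.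
by rewrite linearZ/= mul_mx_scalar -!scalemxAl -scalemxAr scalerDr addrC.
Qed.

Lemma kalman_mean_euler z : kalman_mean P X1 Z1 z =
  expect P X + t *: expect P A + t *: (euler_cov *m H^T)
    *m invmx (t *: (sqrtRn *m sqrtRn + t *: (H *m euler_cov *m H^T)))
    *m (z - (zn + t *: (H *m (expect P X + t *: expect P A)))).
Proof.
rewrite /kalman_mean cross_cov_euler_state_obs cross_cov_euler_obs.
by rewrite expect_euler_obs expect_euler_state.
Qed.

Lemma kalman_cov_euler : kalman_cov P X1 Z1 =
  euler_cov - t *: (euler_cov *m H^T)
    *m invmx (t *: (sqrtRn *m sqrtRn + t *: (H *m euler_cov *m H^T)))
    *m (t *: (H *m euler_cov)).
Proof.
rewrite /kalman_cov cross_cov_euler_state_obs cross_cov_euler_obs.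
by rewrite cross_cov_euler_obs_state cross_cov_euler_state.
Qed.

End EulerStep.

(** * Moments of Brownian increments over one time step *)

Section BrownianIncrement.
Context {R : realType} disp (T : measurableType disp) (P : probability T R).
Variables (F : R -> set_system T) (F_filtration : filtration F).
Variables (s t : R) (s0 : 0 <= s) (t0 : 0 < t).
Variables (n : nat) (W : R -> T -> 'cV[R]_n) (W_brownian : brownian P F W).
Let dW w := W (s + t) w - W s w.

Let st0 : 0 <= s + t. Proof. by rewrite addr_ge0// ltW. Qed.

Let lt_st : s < s + t. Proof. by rewrite ltrDl. Qed.

(** Stated for a general [G] to cover both the filtration at the end of the step and the
    sigma-algebra of the whole process. *)
Lemma increment_measurable G : sigma_algebra setT G ->
  (forall r, 0 <= r -> r <= s + t -> rvec_measurable G (W r)) ->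
  rvec_measurable G dW.
Proof.
move=> sG mW; apply: rvec_measurableD => //; first exact: mW.
by apply: rvec_measurableN => //; apply: mW => //; exact: ltW.
Qed.

Lemma brownian_increment_adapted : rvec_measurable (F (s + t)) dW.
Proof.
have [sF _ FS] := F_filtration; have [mW _ _ _ _] := W_brownian.
apply: increment_measurable; first exact: sF.
by move=> r r0 rst; apply: rvec_measurableS (mW r r0); exact: FS.
Qed.

Lemma brownian_increment_sigma_process : rvec_measurable (sigma_process W) dW.
Proof.
apply: increment_measurable; first exact: smallest_sigma_algebra.
by move=> r r0 _; exact: rvec_measurable_sigma_process.
Qed.

Let mdW : rvec_measurable measurable dW.
Proof.
have [_ Fm _] := F_filtration.
by apply: rvec_measurableS brownian_increment_adapted; exact: Fm.
Qed.

Let dWN : normal_rvec P (Num.sqrt t) dW.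
Proof.
have [_ _ /(_ s (s + t) s0 lt_st) + _ _] := W_brownian.
by rewrite addrAC subrr add0r.
Qed.

Let sqrt0 : 0 < Num.sqrt t. Proof. by rewrite sqrtr_gt0. Qed.

Lemma brownian_increment_square_integrable : square_integrable P dW.
Proof. exact: (normal_rvec_square_integrable sqrt0 mdW dWN). Qed.

Lemma brownian_increment_expect : expect P dW = 0.
Proof. exact: (normal_rvec_expect sqrt0 mdW dWN). Qed.

Lemma brownian_increment_mom : mom P dW dW = t%:M.
Proof. by rewrite (normal_rvec_mom sqrt0 mdW dWN) sqr_sqrtr// ltW. Qed.

(** Independence factors the moment, and the increment has mean zero. *)
Lemma brownian_increment_indep m (X : T -> 'cV[R]_m) :
  rvec_measurable (F s) X -> square_integrable P X -> mom P X dW = 0.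
Proof.
move=> mX X2; have [_ _ _ /(_ s (s + t) s0 lt_st) FdW _] := W_brownian.
rewrite (mom_indep FdW mX (rvec_measurable_sigma_rvec (X := dW)) X2).
  by rewrite brownian_increment_expect trmx0 mulmx0.
exact: brownian_increment_square_integrable.
Qed.

End BrownianIncrement.

Lemma increments_uncorrelated (R : realType) disp (T : measurableType disp)
    (P : probability T R) (F : R -> set_system T) m n
    (W : R -> T -> 'cV[R]_m) (B : R -> T -> 'cV[R]_n) (s t : R) :
  filtration F -> brownian P F W -> brownian P F B ->
  indep P (sigma_process W) (sigma_process B) -> 0 <= s -> 0 < t ->
  mom P (fun w => W (s + t) w - W s w) (fun w => B (s + t) w - B s w) = 0.
Proof.
move=> FF WW BB WB s0 t0.
rewrite (mom_indep WB (brownian_increment_sigma_process s0 t0 (W := W))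
  (brownian_increment_sigma_process s0 t0 (W := B))).
- by rewrite (brownian_increment_expect FF s0 t0 WW) mul0mx.
- exact: (brownian_increment_square_integrable FF s0 t0 WW).
- exact: (brownian_increment_square_integrable FF s0 t0 BB).
Qed.

(** * First-order expansions *)

Section KalmanExpansion.
Context {R : realType} (d h : nat).
Variables (C D AA : 'M[R]_d) (H : 'M[R]_(h, d)) (Rn : 'M[R]_h).
Hypothesis Rnu : Rn \in unitmx.

(** [S] has the shape of [euler_cov], [Rt] is the covariance of the observation divided by t, [K] is
    the Kalman gain and [K0] its limit. *)
Let S t := C + t *: D + t ^+ 2 *: AA.
Let E t := H *m S t *m H^T.
Let Rt t := Rn + t *: E t.
Let G t := invmx (Rt t).
Let K t := S t *m H^T *m G t.
Let K0 := C *m H^T *m invmx Rn.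

Let cvg_id0 : t @[t --> (0 : R)^'+] --> (0 : R).
Proof. exact: cvg_at_right_filter. Qed.

Let cvgS : S t @[t --> (0 : R)^'+] --> C.
Proof.
have <- : C + 0 *: D + (0 * 0) *: AA = C by rewrite mulr0 !scale0r !addr0.
apply: cvgD; [apply: cvgD|]; first exact: cvg_cst.
- by apply: cvgZ; [exact: cvg_id0|exact: cvg_cst].
- apply: cvgZ; last exact: cvg_cst.
  by under eq_cvg do rewrite expr2; apply: cvgM.
Qed.

Let cvgE : E t @[t --> (0 : R)^'+] --> H *m C *m H^T.
Proof.
apply: cvg_mulmx; [apply: cvg_mulmx|]; [exact: cvg_cst|exact: cvgS|].
exact: cvg_cst.
Qed.

Let cvgR : Rt t @[t --> (0 : R)^'+] --> Rn.
Proof.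
have <- : Rn + 0 *: (H *m C *m H^T) = Rn by rewrite scale0r addr0.
apply: cvgD; [exact: cvg_cst|].
by apply: cvgZ; [exact: cvg_id0|exact: cvgE].
Qed.

Let cvgG : G t @[t --> (0 : R)^'+] --> invmx Rn.
Proof. exact: cvg_invmx cvgR. Qed.

Let cvgK : K t @[t --> (0 : R)^'+] --> K0.
Proof.
apply: cvg_mulmx; [apply: cvg_mulmx|]; [exact: cvgS|exact: cvg_cst|].
exact: cvgG.
Qed.

Let near_pos_unit : \forall t \near (0 : R)^'+, 0 < t /\ Rt t \in unitmx.
Proof.
by apply: filterS2 (nbhs_right_gt 0) (near_unitmx Rnu cvgR).
Qed.

Let gainE t : 0 < t -> Rt t \in unitmx ->
  t *: (S t *m H^T) *m invmx (t *: Rt t) = K t.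
Proof.
move=> t0 Ru; have tu : t \is a GRing.unit by rewrite unitfE gt_eqF.
rewrite invmxZ; last by rewrite unitmxZ.
by rewrite -scalemxAl -scalemxAr scalerA divff ?scale1r// gt_eqF.
Qed.

(** The correction equals t K H S exactly, and the terms of order one cancel; what remains in the
    bracket tends to 0 because [K] tends to [K0] and [S] to [C]. *)
Lemma kalman_cov_expansion :
  (fun t => S t - t *: (S t *m H^T) *m invmx (t *: Rt t) *m (t *: (H *m S t))
    - (C + t *: (D - C *m H^T *m invmx Rn *m H *m C)))
  =o_ ((0 : R)^'+) (fun t => t).
Proof.
apply: (eqo_id_at_right (g := fun t =>
    t *: AA - K t *m (H *m S t) + K0 *m (H *m C))).
  apply: filterS near_pos_unit => t [t0 Ru]; rewrite gainE// /S -scalemxAr.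
  rewrite -[K t *m (H *m _)]/(K t *m (H *m S t)) /K0 !mulmxA.
  move: (K t *m H *m S t) (C *m H^T *m _ *m H *m C) => M N.
  mx_ring.
have <- : 0 *: AA - K0 *m (H *m C) + K0 *m (H *m C) = 0.
  by rewrite scale0r sub0r addNr.
apply: cvgD; [apply: cvgB|exact: cvg_cst].
- by apply: cvgZ; [exact: cvg_id0|exact: cvg_cst].
- by apply: cvg_mulmx => //; apply: cvg_mulmx => //; exact: cvg_cst.
Qed.

(** Difference quotient of the gain at 0, in a form free of division by t. *)
Let Lt t := (D + t *: AA) *m H^T *m G t - C *m H^T *m G t *m E t *m invmx Rn.

Let KB t : Rt t \in unitmx -> K t - K0 = t *: Lt t.
Proof.
(* Resolvent identity, obtained by writing [Rn] as [Rt t - t *: E t] between the two inverses. *)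
move=> Ru; have GE : G t = invmx Rn - t *: (G t *m E t *m invmx Rn).
  rewrite -[LHS]mulmx1 -(mulmxV Rnu) mulmxA.
  rewrite -[X in _ *m X *m _](addrK (t *: E t)).
  rewrite -/(Rt t) mulmxBr mulVmx// mulmxBl mul1mx -scalemxAr -scalemxAl.
  by [].
have CG : C *m H^T *m G t = C *m H^T *m invmx Rn
    - t *: (C *m H^T *m G t *m E t *m invmx Rn).
  by rewrite {1}GE mulmxBr -scalemxAr !mulmxA.
rewrite /K /K0 /Lt {1}/S !mulmxDl {1}CG -!scalemxAl.
mx_ring.
Qed.

Let cvgL : exists L : 'M[R]_(d, h), Lt t @[t --> (0 : R)^'+] --> L.
Proof.
exists ((D + 0 *: AA) *m H^T *m invmx Rn
  - C *m H^T *m invmx Rn *m (H *m C *m H^T) *m invmx Rn).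
apply: cvgB.
- apply: cvg_mulmx => //; apply: cvg_mulmx; last exact: cvg_cst.
  apply: cvgD; first exact: cvg_cst.
  by apply: cvgZ; [exact: cvg_id0|exact: cvg_cst].
- apply: cvg_mulmx; last exact: cvg_cst.
  apply: cvg_mulmx; last exact: cvgE.
  by apply: cvg_mulmx => //; exact: cvg_cst.
Qed.

(** The innovation is only of order sqrt t, so convergence of the gain would not suffice: its error
    [t *: Lt t] is of order t, and multiplied by a vanishing innovation it gives o(t). *)
Lemma kalman_mean_expansion (x a : 'cV[R]_d) (zn : 'cV[R]_h)
    (z : R -> 'cV[R]_h) :
  (fun t => z t - zn) =O_ ((0 : R)^'+) (fun t => Num.sqrt t) ->
  (fun t => x + t *: a + t *: (S t *m H^T) *m invmx (t *: Rt t)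
      *m (z t - (zn + t *: (H *m (x + t *: a))))
    - (x + t *: a + K0 *m (z t - zn - t *: (H *m x))))
  =o_ ((0 : R)^'+) (fun t => t).
Proof.
move=> zO; have [L cL] := cvgL.
have cz : z t - zn @[t --> (0 : R)^'+] --> (0 : 'cV[R]_h).
  move/eqO_exP : zO => [c /= c0 zc].
  apply/cvgr0Pnorm_le => e e0.
  have csqrt : Num.sqrt t @[t --> (0 : R)^'+] --> (0 : R).
    rewrite -[X in _ --> X](sqrtr0 R); apply: cvg_at_right_filter.
    exact: sqrt_continuous.
  move/cvgr0Pnorm_le : csqrt => /(_ (e / c) (divr_gt0 e0 c0)) sc.
  near=> t; have zt : `|z t - zn| <= c * `|Num.sqrt t| by near: t.
  apply: le_trans zt _; rewrite mulrC -ler_pdivlMr//.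
  by near: t.
apply: (eqo_id_at_right (g := fun t =>
    Lt t *m (z t - zn - t *: (H *m x)) - t *: (K t *m H *m a))).
  apply: filterS near_pos_unit => t [t0 Ru]; rewrite gainE//.
  set u := z t - zn - t *: (H *m x).
  have -> : z t - (zn + t *: (H *m (x + t *: a))) = u - t *: (t *: (H *m a)).
    by rewrite /u mulmxDr -scalemxAr; mx_ring.
  rewrite scalerBr [t *: (Lt t *m u)]scalemxAl -(KB Ru) mulmxBl mulmxBr.
  rewrite -!scalemxAr mulmxA; mx_ring.
have <- : L *m (0 - 0 *: (H *m x)) - 0 *: (K0 *m H *m a) = 0.
  by rewrite !scale0r !subr0 mulmx0.
apply: cvgB.
- apply: cvg_mulmx => //; apply: cvgB => //.
  by apply: cvgZ; [exact: cvg_id0|exact: cvg_cst].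
- apply: cvgZ; first exact: cvg_id0.
  by apply: cvg_mulmx; [apply: cvg_mulmx => //|]; exact: cvg_cst.
Unshelve. all: by end_near. Qed.

End KalmanExpansion.

(** * Blocks of the covariance rate in the low-rank basis *)

Section LowRankRates.
Context {R : realType} (d h k : nat).
Variables (U : 'M[R]_(k, d)) (CY : 'M[R]_k) (H : 'M[R]_(h, d)).
Variables (YA : 'M[R]_(k, d)) (Q sqrtQ : 'M[R]_d) (Ri sqrtRi : 'M[R]_h).
Hypotheses (UU : U *m U^T = 1%:M) (CYT : CY^T = CY).
Hypotheses (sqrtQT : sqrtQ^T = sqrtQ) (QE : sqrtQ *m sqrtQ = Q).
Hypotheses (sqrtRiT : sqrtRi^T = sqrtRi) (RiE : sqrtRi *m sqrtRi = Ri).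
Let Cn := U^T *m CY *m U.
(** [M] is the rate of the target covariance, with [YA] the moment of Y against the centred drift.
    Up to sign, [J] and [N] are the coefficients in [dY] of [dt *: Y] and of the observation noise,
    [Ri] being the inverse of R. *)
Let M := U^T *m YA + YA^T *m U + Q - Cn *m H^T *m Ri *m H *m Cn.
Let J := CY *m U *m H^T *m Ri *m H *m U^T.
Let N := CY *m U *m H^T *m sqrtRi.

Let QT : Q^T = Q. Proof. by rewrite -QE trmx_mul sqrtQT. Qed.

Let RiT : Ri^T = Ri. Proof. by rewrite -RiE trmx_mul sqrtRiT. Qed.

Lemma cov_rate_tr : M^T = M.
Proof.
have CnT : Cn^T = Cn by rewrite /Cn !trmx_mul trmxK CYT mulmxA.
rewrite /M; move: Cn CnT => C CT.
rewrite [LHS]linearB/= [(_ + Q)^T]linearD/= [(_ + YA^T *m U)^T]linearD/=.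
by rewrite !trmx_mul !trmxK RiT CT QT !mulmxA [YA^T *m U + _]addrC.
Qed.

(** [J *m CY], its transpose and [N *m N^T] are one and the same matrix. It is subtracted twice by
    the damping and added once by the noise, leaving the single quadratic term of [M]. *)
Lemma cov_rate_U_rate :
  YA *m U^T - CY *m J^T + (U *m YA^T - J *m CY)
    + ((U *m sqrtQ) *m (U *m sqrtQ)^T + N *m N^T) = U *m M *m U^T.
Proof.
have JT : CY *m J^T = CY *m U *m H^T *m Ri *m H *m U^T *m CY.
  by rewrite /J !trmx_mul !trmxK CYT RiT !mulmxA.
have NN : N *m N^T = CY *m U *m H^T *m Ri *m H *m U^T *m CY.
  by rewrite /N !trmx_mul !trmxK CYT sqrtRiT -RiE !mulmxA.
have QQ : (U *m sqrtQ) *m (U *m sqrtQ)^T = U *m Q *m U^T.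
  by rewrite trmx_mul sqrtQT -QE !mulmxA.
have UCn : U *m Cn = CY *m U by rewrite /Cn !mulmxA UU mul1mx.
have CnU : Cn *m U^T = U^T *m CY by rewrite /Cn -!mulmxA UU mulmx1.
have -> : U *m M *m U^T = YA *m U^T + U *m YA^T + U *m Q *m U^T
    - CY *m U *m H^T *m Ri *m H *m U^T *m CY.
  rewrite /M; move: Cn UCn CnU => C UC CU.
  rewrite mulmxBr mulmxBl !(mulmxDr, mulmxDl) !mulmxA UU !mul1mx UC.
  rewrite -[U *m YA^T *m U *m U^T]mulmxA UU mulmx1.
  by rewrite -[_ *m C *m U^T]mulmxA CU !mulmxA.
rewrite JT NN QQ /J; mx_ring.
Qed.

(** The complementary projector kills every term ending in [U] or [Cn]; what survives is the rate in
    [dU] before multiplication by [invmx CY]. *)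
Lemma cov_rate_P_rate : U *m M *m (1%:M - U^T *m U) =
  YA *m (1%:M - U^T *m U) + U *m Q *m (1%:M - U^T *m U).
Proof.
set Pp := 1%:M - U^T *m U.
have UPp : U *m Pp = 0 by rewrite /Pp mulmxBr mulmx1 mulmxA UU mul1mx subrr.
have CPp : Cn *m Pp = 0 by rewrite /Cn -!mulmxA UPp !mulmx0.
rewrite /M; move: Cn CPp UPp => C; move: Pp => P' CP UP.
rewrite mulmxBr mulmxBl !(mulmxDr, mulmxDl) -!mulmxA UP CP !mulmx0.
by rewrite subr0 addr0 !mulmxA UU !mul1mx.
Qed.

End LowRankRates.

(** * The low-rank Euler step as a first-order minimizer *)

Theorem proposition3p2 (R : realType) (disp : measure_display)
  (Omega : measurableType disp) (P : probability Omega R)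
  (d h k : nat) (hd : (h <= d)%N)
  (F : R -> set_system Omega) (F_filtration : filtration F)
  (W : R -> Omega -> 'cV[R]_d) (W_brownian : brownian P F W)
  (B : R -> Omega -> 'cV[R]_h) (B_brownian : brownian P F B)
  (WB_indep : indep P (sigma_process W) (sigma_process B))
  (A : R -> 'cV[R]_d -> 'cV[R]_d)
  (A_borel : forall t, 0 <= t -> borel_map (A t))
  (H : R -> 'M[R]_(h, d))
  (Q sqrtQ : 'M[R]_d) (Q_psd : psd Q) (sqrtQP : is_psd_sqrt sqrtQ Q)
  (Rn sqrtRn : 'M[R]_h) (Rn_posdef : posdef Rn)
  (sqrtRnP : is_psd_sqrt sqrtRn Rn)
  (tn : R) (tn_ge0 : 0 <= tn)
  (mn : 'cV[R]_d)
  (U : 'M[R]_(k, d)) (U_orthonormal : U *m U^T = 1%:M)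
  (Y : Omega -> 'cV[R]_k) (Y_adapted : rvec_measurable (F tn) Y)
  (Y_L2 : square_integrable P Y) (Y_mean0 : expect P Y = 0)
  (Y_free : linearly_independent P Y)
  (zn : 'cV[R]_h) :
  let Xn w := mn + U^T *m Y w in
  let An w := A tn (Xn w) in
  let CY := expect P (fun w => Y w *m (Y w)^T) in
  let Cn := U^T *m CY *m U in
  let Hn := H tn in
  let Pperp := 1%:M - U^T *m U in
  let dW dt w := W (tn + dt) w - W tn w in
  let dB dt w := B (tn + dt) w - B tn w in
  (* full-order Euler--Maruyama step *)
  let X1 dt w := Xn w + dt *: An w + sqrtQ *m dW dt w in
  let Z1 dt w := zn + dt *: (Hn *m X1 dt w) + sqrtRn *m dB dt w in
  (* first-order targets; z is the observed value of Z1 *)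
  let mtar dt (z : 'cV[R]_h) := mn + dt *: expect P An
    + Cn *m Hn^T *m invmx Rn *m (z - zn - dt *: (Hn *m expect P Xn)) in
  let Ctar dt := Cn + dt *:
    (expect P (fun w => centered P Xn w *m (centered P An w)^T)
     + expect P (fun w => centered P An w *m (centered P Xn w)^T)
     + Q - Cn *m Hn^T *m invmx Rn *m Hn *m Cn) in
  (* DLRA increments *)
  let dm dt (z : 'cV[R]_h) := dt *: expect P An
    + U^T *m CY *m U *m Hn^T *m invmx Rn
        *m (z - zn - dt *: (Hn *m expect P Xn)) in
  let dU dt :=
    dt *: (invmx CY *m expect P (fun w => Y w *m (centered P An w)^T) *m Pperp)
    + dt *: (invmx CY *m U *m Q *m Pperp) in
  let dY dt w := dt *: (U *m centered P An w) + U *m sqrtQ *m dW dt w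
    - dt *: (CY *m U *m Hn^T *m invmx Rn *m Hn *m U^T *m Y w)
    - CY *m U *m Hn^T *m invmx sqrtRn *m dB dt w in
  square_integrable P An ->
  [/\ (* the targets are the first-order expansions of the Kalman quantities *)
      forall zobs : R -> 'cV[R]_h,
        (fun dt => zobs dt - zn) =O_ ((0 : R)^'+) (fun dt => Num.sqrt dt) ->
        (fun dt => kalman_mean P (X1 dt) (Z1 dt) (zobs dt) - mtar dt (zobs dt))
          =o_ ((0 : R)^'+) (fun dt => dt),
      (fun dt => kalman_cov P (X1 dt) (Z1 dt) - Ctar dt)
        =o_ ((0 : R)^'+) (fun dt => dt),
      (* linear part of the surrogate covariance *)
      (fun x : 'M[R]_(k, d) * 'M[R]_k =>
         surrogate_cov U CY x.1 x.2 - linear_surrogate_cov U CY x.1 x.2)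
        =o_ (nbhs (0 : 'M[R]_(k, d) * 'M[R]_k)) id,
      (* admissibility of dY *)
      forall dt, 0 < dt ->
        rvec_measurable (F (tn + dt)) (dY dt) /\ square_integrable P (dY dt) &
      exists dCmin : R -> 'M[R]_k,
        (forall dt z, 0 < dt ->
           is_minimizer U CY (mtar dt z) (Ctar dt) mn
             (dm dt z) (dU dt) (dCmin dt) /\
           (forall dm' dU' dC',
              is_minimizer U CY (mtar dt z) (Ctar dt) mn dm' dU' dC' ->
              dC' = dCmin dt)) /\
        (fun dt => expect P (fun w => (Y w + dY dt w) *m (Y w + dY dt w)^T)
                   - CY - dCmin dt)
          =o_ ((0 : R)^'+) (fun dt => dt)].
Proof.
move=> Xn An CY Cn Hn Pperp dW dB X1 Z1 mtar Ctar dm dU dY An2.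
have [sF Fm FS] := F_filtration.
have sFn := sF _ tn_ge0.
have CYpos : posdef CY := mom_posdef Y_L2 Y_free.
have CYu := posdef_unitmx CYpos.
have [CYT _] := CYpos.
have Ru := posdef_unitmx Rn_posdef.
have [[sQT _] sQE] := sqrtQP.
have [[sRT _] sRE] := sqrtRnP.
have sRu : sqrtRn \in unitmx by move: Ru; rewrite -sRE unitmx_mul => /andP[].
have sRiT : (invmx sqrtRn)^T = invmx sqrtRn by rewrite trmx_inv sRT.
have RiE : invmx sqrtRn *m invmx sqrtRn = invmx Rn.
  have RiR : Rn *m (invmx sqrtRn *m invmx sqrtRn) = 1%:M.
    by rewrite -{1}sRE mulmxA -(mulmxA sqrtRn) mulmxV// mulmx1 mulmxV.
  by rewrite -[LHS](mulKmx Ru) RiR mulmx1.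
have Xn2 : square_integrable P Xn.
  by rewrite /Xn; square_int.
have mXn : rvec_measurable (F tn) Xn.
  apply: rvec_measurableD => //; first exact: rvec_measurable_cst.
  exact: rvec_measurableM.
have mAn : rvec_measurable (F tn) An.
  exact: (rvec_measurable_comp sFn (A_borel _ tn_ge0) mXn).
have EXn : expect P Xn = mn.
  rewrite expectD; [|by square_int..].
  by rewrite expect_cst expectMl// Y_mean0 mulmx0 addr0.
(* As Y has mean zero, all the moments of the state reduce to those of Y. *)
have cXn : centered P Xn = (fun w => U^T *m Y w).
  by apply/funext => w; rewrite /centered EXn /Xn addrC addKr.
set Ac := centered P An; set Xc := centered P Xn.
have Ac2 : square_integrable P Ac by rewrite /Ac; square_int.
have Xc2 : square_integrable P Xc by rewrite /Xc; square_int.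
have m_centered n (X : Omega -> 'cV[R]_n) : rvec_measurable (F tn) X ->
    rvec_measurable (F tn) (centered P X).
  by move=> mX; apply: rvec_measurableD => //; exact: rvec_measurable_cst.
have mAc : rvec_measurable (F tn) Ac by exact: m_centered.
have mXc : rvec_measurable (F tn) Xc by exact: m_centered.
have W2 t : 0 < t -> square_integrable P (dW t).
  move=> t0.
  exact: (brownian_increment_square_integrable F_filtration tn_ge0 t0).
have B2 t : 0 < t -> square_integrable P (dB t).
  move=> t0.
  exact: (brownian_increment_square_integrable F_filtration tn_ge0 t0).
have W0 t : 0 < t -> expect P (dW t) = 0.
  by move=> t0; exact: (brownian_increment_expect F_filtration tn_ge0 t0).
have B0 t : 0 < t -> expect P (dB t) = 0.
  by move=> t0; exact: (brownian_increment_expect F_filtration tn_ge0 t0).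
have WW t : 0 < t -> mom P (dW t) (dW t) = t%:M.
  by move=> t0; exact: (brownian_increment_mom F_filtration tn_ge0 t0).
have BB t : 0 < t -> mom P (dB t) (dB t) = t%:M.
  by move=> t0; exact: (brownian_increment_mom F_filtration tn_ge0 t0).
have WB t : 0 < t -> mom P (dW t) (dB t) = 0.
  by move=> t0; exact: (increments_uncorrelated F_filtration).
have XdW t n (X : Omega -> 'cV[R]_n) : 0 < t -> rvec_measurable (F tn) X ->
    square_integrable P X -> mom P X (dW t) = 0.
  by move=> t0; exact: (brownian_increment_indep F_filtration tn_ge0 t0).
have XdB t n (X : Omega -> 'cV[R]_n) : 0 < t -> rvec_measurable (F tn) X ->
    square_integrable P X -> mom P X (dB t) = 0.
  by move=> t0; exact: (brownian_increment_indep F_filtration tn_ge0 t0).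
have XX : mom P Xc Xc = Cn.
  by rewrite /Xc cXn momMl ?momMr ?trmxK ?mulmxA//; square_int.
have XA : mom P Xc Ac = U^T *m mom P Y Ac by rewrite /Xc cXn momMl.
have AX : mom P Ac Xc = (mom P Y Ac)^T *m U.
  by rewrite -mom_tr XA trmx_mul trmxK.
pose D := mom P Xc Ac + mom P Ac Xc + Q.
pose M := D - Cn *m Hn^T *m invmx Rn *m Hn *m Cn.
have CtarE t : Ctar t = Cn + t *: M by [].
have ME : M = U^T *m mom P Y Ac + (mom P Y Ac)^T *m U + Q
    - Cn *m Hn^T *m invmx Rn *m Hn *m Cn.
  by rewrite /M /D XA AX.
have MT : M^T = M.
  by rewrite ME; exact: (cov_rate_tr _ _ _ CYT sQT sQE sRiT RiE).
split.
- move=> zobs zobsO.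
  apply: eqo_at_right_ext (kalman_mean_expansion Cn D (mom P Ac Ac) Hn Ru
    (expect P Xn) (expect P An) zobsO) => t t0.
  have -> := kalman_mean_euler (W2 t t0) (B2 t t0) Xn2 An2 (W0 t t0) (B0 t t0)
    (WW t t0) (BB t t0) (WB t t0) (XdW t _ _ t0 mXc Xc2) (XdB t _ _ t0 mXc Xc2)
    (XdW t _ _ t0 mAc Ac2) (XdB t _ _ t0 mAc Ac2) Hn zn sQT sRT (zobs t).
  (* The leading mean of the first-order target is [mn] in [mtar], while the one under [Hn] stays an
     expectation. *)
  by rewrite /euler_cov -/Xc -/Ac XX sRE sQE {5}EXn.
- apply: eqo_at_right_ext
    (kalman_cov_expansion Cn D (mom P Ac Ac) Hn Ru) => t t0.
  have -> := kalman_cov_euler (W2 t t0) (B2 t t0) Xn2 An2 (W0 t t0) (B0 t t0)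
    (WW t t0) (BB t t0) (WB t t0) (XdW t _ _ t0 mXc Xc2) (XdB t _ _ t0 mXc Xc2)
    (XdW t _ _ t0 mAc Ac2) (XdB t _ _ t0 mAc Ac2) Hn zn sQT sRT.
  by rewrite /euler_cov -/Xc -/Ac XX sRE sQE.
- exact: surrogate_cov_linearization.
- move=> t t0; split.
    have st0 : 0 <= tn + t by rewrite addr_ge0// ltW.
    have sFt := sF _ st0.
    have up n (X : Omega -> 'cV[R]_n) : rvec_measurable (F tn) X ->
        rvec_measurable (F (tn + t)) X.
      by apply: rvec_measurableS; apply: FS => //; rewrite lerDl ltW.
    apply: rvec_measurableD => //; last first.
      apply: rvec_measurableN => //; apply: rvec_measurableM => //.
      exact: (brownian_increment_adapted F_filtration tn_ge0 t0 B_brownian).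
    apply: rvec_measurableD => //; last first.
      apply: rvec_measurableN => //; apply: rvec_measurableZ => //.
      by apply: rvec_measurableM => //; exact: up.
    apply: rvec_measurableD => //.
      apply: rvec_measurableZ => //; apply: rvec_measurableM => //.
      exact: up.
    apply: rvec_measurableM => //.
    exact: (brownian_increment_adapted F_filtration tn_ge0 t0 W_brownian).
  have := W2 t t0; have := B2 t t0; rewrite /dY -/Ac.
  by move: (dW t) (dB t) => w b w2 b2; square_int.
(* These split [dY] into [t *: a], with [a] measurable for [F tn], and a noise [xi] uncorrelated
   with the past. *)
pose J := CY *m U *m Hn^T *m invmx Rn *m Hn *m U^T.
pose N := CY *m U *m Hn^T *m invmx sqrtRn.
pose a w := U *m Ac w - J *m Y w.
(* The witness is the least-squares [dC] for the increment [t *: M] of the target covariance. *)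
exists (fun t => U *m (t *: M) *m U^T); split.
- move=> t z t0; have tMT : (t *: M)^T = t *: M by rewrite linearZ/= MT.
  have dUE : dU t = invmx CY *m U *m (t *: M) *m (1%:M - U^T *m U).
    rewrite -scalemxAr -scalemxAl -!mulmxA [U *m (M *m _)]mulmxA ME.
    rewrite (cov_rate_P_rate _ _ _ _ _ U_orthonormal) mulmxDr scalerDr.
    by rewrite /dU -!mulmxA.
  (* The mean increment fits its target exactly. *)
  have mtarE : mtar t z = mn + dm t z by rewrite /mtar /dm /Cn addrA.
  rewrite mtarE CtarE dUE; split; first exact: least_squares_minimizer.
  by move=> dm' dU' dC'; exact: least_squares_unique.
- have a2 : square_integrable P a by rewrite /a; square_int.
  have ma : rvec_measurable (F tn) a.
    apply: rvec_measurableD => //; first exact: rvec_measurableM.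
    by apply: rvec_measurableN => //; exact: rvec_measurableM.
  (* The error is exactly t^2 times the second moment of [a]. *)
  apply: (eqo_at_right_ext (g := fun t => t *: (t *: mom P a a)));
    last first.
    apply: (eqo_id_at_right (g := fun t => t *: mom P a a)); first exact: nearW.
    rewrite -(scale0r (mom P a a)); apply: cvgZ; last exact: cvg_cst.
    exact: cvg_at_right_filter.
  move=> t t0.
  pose xi w := (U *m sqrtQ) *m dW t w - N *m dB t w.
  have xi2 : square_integrable P xi.
    have := W2 t t0; have := B2 t t0; rewrite /xi.
    by move: (dW t) (dB t) => w b w2 b2; square_int.
  have NB2 : square_integrable P (fun w => - (N *m dB t w)).
    by have := B2 t t0; move: (dB t) => b b2; square_int.
  have QW2 : square_integrable P (fun w => (U *m sqrtQ) *m dW t w).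
    by have := W2 t t0; move: (dW t) => b b2; square_int.
  have Xxi n (X : Omega -> 'cV[R]_n) : rvec_measurable (F tn) X ->
      square_integrable P X -> mom P X xi = 0.
    move=> mX X2; rewrite (momDr X2 QW2 NB2) momNr//; last first.
      by have := B2 t t0; move: (dB t) => b b2; square_int.
    rewrite !momMr//; [|exact: B2|exact: W2].
    by rewrite XdW// XdB// !mul0mx oppr0 addr0.
  have -> : (fun w => (Y w + dY t w) *m (Y w + dY t w)^T) =
      (fun w => (Y w + t *: a w + xi w) *m (Y w + t *: a w + xi w)^T).
    apply/funext => w; congr (_ *m _^T); rewrite /dY /a /xi -/Ac -/J -/N;
    mx_ring.
  rewrite -/(mom P (fun w => _) (fun w => _)).
  rewrite (mom_step t Y_L2 a2 xi2 (Xxi _ _ Y_adapted Y_L2) (Xxi _ _ ma a2)).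
  rewrite (mom_noise _ _ (W2 t t0) (B2 t t0) (WW t t0) (BB t t0) (WB t t0)).
  have Ya : mom P Y a = mom P Y Ac *m U^T - CY *m J^T.
    rewrite (momDr Y_L2); [|by square_int..].
    by rewrite momNr ?momMr//; square_int.
  have aY : mom P a Y = U *m (mom P Y Ac)^T - J *m CY.
    rewrite -mom_tr Ya linearB/= !trmx_mul !trmxK CYT.
    by [].
  (* The coefficient of t in the moment of [Y + dY] is [U *m M *m U^T], so it cancels against the
     witness. *)
  rewrite -scalemxAr -scalemxAl ME.
  rewrite -(cov_rate_U_rate _ _ U_orthonormal CYT sQT sQE sRiT RiE).
  rewrite -Ya -aY -/CY -/J -/N.
  move: (mom P Y a) (mom P a Y) (mom P a a) => m1 m2 m3.
  mx_ring.
Qed.
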